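(* Let $G$ be a simple graph with vertex set $[d]$, where $d\ge3$, and let $\Delta_G$ be its (truncated) coloring complex. (1) For each edge $e=\{i,j\}$ of $G$, the $(d-1)!$ $e$-permutations give exactly $(d-1)!$ distinct facets of $\Delta_G$, and the facets so obtained, over all edges of $G$, are all the facets of $\Delta_G$; the sets of facets corresponding to two distinct edges are disjoint. The facets corresponding to one edge form a $(d-3)$-sphere (the edge-sphere of $e$), isomorphic to the order complex of the truncated Boolean algebra on $d-1$ elements, i.e. to the first barycentric subdivision of the boundary of a $(d-2)$-simplex. In particular $\Delta_G$ has dimension $d-3$, unless $G$ has no edges, in which case $\Delta_G$ is the empty complex (it has no faces). (2) Any two distinct edge-spheres intersect in a $(d-4)$-sphere isomorphic to the order complex of the truncated Boolean algebra on $d-2$ elements. Moreover, if $e$ and $f=\{i,j\}$ are two distinct edges, then the intersection of their edge-spheres separates the $e$-sphere into two halves, one of which contains all vertices of the $e$-sphere that contain $i$ and not $j$, while the other contains those vertices that contain $j$ and not $i$.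
   Context: $G$ is a simple graph with vertex set $[d]$. For $\pi=a_1\cdots a_d\in\mathcal S_d$ and $k\in[d]$, $\ell(k)$ is the largest $r\ge0$ such that there are indices $i_0<\cdots<i_r=k$ with $a_{i_{s-1}}$ adjacent to $a_{i_s}$ in $G$ for all $s$. An integer $k\in\{0,\dots,d-1\}$ is a cut of $\pi$ if $k=0$, or $\ell(k)<\ell(k+1)$, or $\ell(k)=\ell(k+1)$ and $a_k<a_{k+1}$. If the cuts are $0=i_1<\cdots<i_q$, the $G$-sequence of $\pi$ is $S_1,\dots,S_q$ with $S_j=\{a_{i_j+1},\dots,a_{i_{j+1}}\}$ for $j<q$ and $S_q=\{a_{i_q+1},\dots,a_d\}$; the short $G$-sequence is $S_1,\dots,S_{q-1}$. A basic chain is a chain $\emptyset\subsetneq S_1\subsetneq\cdots\subsetneq S_k\subsetneq[d]$ ($k\ge0$) such that some $\pi\in\mathcal S_d$ has short $G$-sequence $S_1,S_2\setminus S_1,\dots,S_k\setminus S_{k-1}$. The truncated Boolean algebra $\hat B_d$ is the poset of nonempty proper subsets of $[d]$; its order complex has as faces the chains in $\hat B_d$. The (truncated) coloring complex $\Delta_G$ is the subcomplex of the order complex of $\hat B_d$ whose faces are the chains of nonempty proper subsets of $[d]$ that contain no basic chain as a subset (equivalently, its face ring is the face ring of the order complex of $\hat B_d$ modulo the ideal generated by the monomials $x_{S_1}\cdots x_{S_k}$ of basic chains). For an edge $e=\{i,j\}$ of $G$, an $e$-permutation is a permutation $b_1b_2\cdots b_{d-1}$ of the set $([d]\setminus\{i,j\})\cup\{e\}$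 (so $e$ is treated as a single letter); the facet corresponding to it is $\{T_1,\dots,T_{d-2}\}$ where $T_m$ is the union of $b_1,\dots,b_m$, with the letter $e$ contributing the two elements $i,j$. (E.g. for $e=\{2,5\}$, $d=5$, the $e$-permutation $3,e,1,4$ gives the facet $\{\{3\},\{2,3,5\},\{1,2,3,5\}\}$.) *)

(* Defs.v *)
From mathcomp Require Import all_boot all_order all_fingroup all_algebra.
From mathcomp Require Import all_classical all_reals all_analysis.
From mathcomp Require Import finset.

Set Implicit Arguments.
Unset Strict Implicit.
Unset Printing Implicit Defensive.

Import Order.TTheory GRing.Theory Num.Theory.
Import numFieldNormedType.Exports.

Local Open Scope nat_scope.
Local Open Scope set_scope.

(** * Finite abstract simplicial complexes *)

(* A complex on the vertex type [V] is the finite set of its faces. The void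
   complex [set0] (no faces) differs from [[set set0]] (only the empty face). *)
Section Complexes.
Variable V : finType.
Implicit Types (K P : {set {set V}}) (F : {set V}).

Definition is_complex K : bool :=
  [forall F in K, forall F' : {set V}, (F' \subset F) ==> (F' \in K)].

Definition facets K : {set {set V}} := [set F | maxset (fun F' => F' \in K) F].

(* For the void complex this returns -1, the dimension of [[set set0]]. *)
Definition complex_dim K : int := ((\max_(F in K) #|F|)%:Z - 1)%R.

Definition is_chain (C : {set {set V}}) : bool :=
  [forall A in C, forall B in C, (A \subset B) || (B \subset A)].

Definition order_complex P : {set {set {set V}}} :=
  [set C : {set {set V}} | (C \subset P) && is_chain C].

Definition barycentric_subdivision K : {set {set {set V}}} :=
  order_complex (K :\ set0).

End Complexes.

Definition complex_iso (V W : finType) (K : {set {set V}}) (L : {set {set W}}) :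
    Prop :=
  exists f : V -> W,
    {in [pred v | [set v] \in K] &, injective f} /\
    [set f @: F | F : {set V} in K] = L.

Definition boolean_hat (n : nat) : {set {set 'I_n}} :=
  [set S | (S != set0) && (S != setT)].

(* The boundary of the simplex with [n] vertices, of dimension [n - 1]. *)
Definition simplex_boundary (n : nat) : {set {set 'I_n}} := [set F | F != setT].

(** * Geometric realizations *)

Section Realization.
Variable R : realType.
Local Open Scope ring_scope.

(* Barycentric coordinates: the coordinate at [v] is entry [enum_rank v]. *)
Definition realization (V : finType) (K : {set {set V}}) : set 'rV[R]_#|V| :=
  [set x : 'rV[R]_#|V| |
    [/\ forall v : V, 0 <= x 0 (enum_rank v),
        \sum_(v : V) x 0 (enum_rank v) = 1 &
        [set v | x 0 (enum_rank v) != 0]%SET \in K]]%classic.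

Definition unit_sphere (n : nat) : set 'rV[R]_n :=
  [set x : 'rV[R]_n | \sum_(k < n) x 0 k ^+ 2 = 1]%classic.

Definition homeomorphic (X Y : topologicalType) (A : set X) (B : set Y) : Prop :=
  exists (f : X -> Y) (g : Y -> X),
    [/\ ({within A, continuous f} /\ {within B, continuous g})%classic,
        forall x, A x -> B (f x),
        forall y, B y -> A (g y),
        forall x, A x -> g (f x) = x &
        forall y, B y -> f (g y) = y].

(* [K] is an [(n - 1)]-sphere; for [n = 0] both sides are empty. *)
Definition sphere_in_dim (n : nat) (V : finType) (K : {set {set V}}) : Prop :=
  homeomorphic (realization K) (@unit_sphere n).

(* [H1] and [H2] are the closed halves, [U1] and [U2] the two components of the
   complement of [A] in [X]. *)
Definition separates_into_halves (V : finType) (X A H1 H2 : {set {set V}}) :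
    Prop :=
  let U1 := (realization H1 `\` realization A)%classic in
  let U2 := (realization H2 `\` realization A)%classic in
  [/\ [/\ is_complex H1, is_complex H2, X = H1 :|: H2 & A = H1 :&: H2],
      #|facets H1| = #|facets H2|,
      (realization X `\` realization A = U1 `|` U2)%classic,
      separated U1 U2 &
      [/\ (U1 !=set0)%classic, (U2 !=set0)%classic, connected U1 & connected U2]].

End Realization.

(** * The coloring complex *)

(* Vertices and positions are numbered [0, ..., d - 1] instead of
   [1, ..., d], and a permutation [pi] is read as the word
   [pi 0, pi 1, ..., pi (d - 1)]. *)
Section Coloring.
Variables (d : nat) (G : rel 'I_d).
Implicit Types (pi : {perm 'I_d}) (i j k : 'I_d).

(* The bound [r < d] is harmless since [i_0 < ... < i_r] are positions. *)
Definition ell pi k : nat :=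
  \max_(r < d | [exists i0 : 'I_d, exists s : r.-tuple 'I_d,
                   path [rel i j : 'I_d | (i < j) && G (pi i) (pi j)] i0 s
                   && (last i0 s == k)]) r.

(* [k] is a cut when the word is cut just before position [k], that is, after
   its first [k] letters. *)
Definition is_cut pi k : bool :=
  (k == 0 :> nat) ||
  [exists j : 'I_d, (j.+1 == k :> nat) &&
     ((ell pi j < ell pi k) || (ell pi j == ell pi k) && (pi j < pi k))].

Definition cuts pi : seq nat := [seq val k | k <- enum 'I_d & is_cut pi k].

Definition block pi (m n : nat) : {set 'I_d} :=
  [set pi k | k : 'I_d & m <= k < n].

Definition G_sequence pi : seq {set 'I_d} :=
  [seq block pi c.1 c.2 | c <- zip (cuts pi) (rcons (behead (cuts pi)) d)].

Definition short_G_sequence pi : seq {set 'I_d} :=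
  take (size (G_sequence pi)).-1 (G_sequence pi).

(* A chain [C] is listed increasingly as [S_1, ..., S_k]. *)
Definition basic_chain (C : {set {set 'I_d}}) : bool :=
  [exists s : #|C|.-tuple {set 'I_d},
    [&& C == [set S in s],
        path (fun A B : {set 'I_d} => A \proper B) set0 (rcons s setT) &
        [exists pi : {perm 'I_d},
          short_G_sequence pi ==
          pairmap (fun A B : {set 'I_d} => B :\: A) set0 s]]].

Definition coloring_complex : {set {set {set 'I_d}}} :=
  [set F in order_complex (boolean_hat d) |
    [forall C : {set {set 'I_d}}, basic_chain C ==> ~~ (C \subset F)]].

Definition edges : {set {set 'I_d}} :=
  [set [set p.1; p.2] | p : 'I_d * 'I_d & G p.1 p.2].

End Coloring.

(** * Edge-spheres *)

Section EdgeSpheres.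
Variables (d : nat) (e : {set 'I_d}).

(* A letter is encoded by the set of elements it contributes: the letter [x]
   outside [e] by [[set x]], and the letter [e] by [e] itself. *)
Definition letters : {set {set 'I_d}} := e |: [set [set x] | x in ~: e].

Definition edge_perms : {set d.-1.-tuple {set 'I_d}} :=
  [set b : d.-1.-tuple {set 'I_d} | perm_eq b (enum letters)].

Definition facet_of (b : d.-1.-tuple {set 'I_d}) : {set {set 'I_d}} :=
  [set (\bigcup_(L <- take m.+1 b) L)%SET | m : 'I_d.-2].

Definition edge_facets : {set {set {set 'I_d}}} := facet_of @: edge_perms.

Definition edge_sphere : {set {set {set 'I_d}}} :=
  [set F : {set {set 'I_d}} | [exists T in edge_facets, F \subset T]].

End EdgeSpheres.

(* Main.v *)
Require Import Defs.
From mathcomp Require Import all_boot all_order all_fingroup all_algebra.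
From mathcomp Require Import all_classical all_reals all_analysis.
From mathcomp Require Import zify fintype finset.

Set Implicit Arguments.
Unset Strict Implicit.
Unset Printing Implicit Defensive.

Import Order.TTheory GRing.Theory Num.Theory.
Import numFieldNormedType.Exports.

(** The blocks of a G-sequence are independent sets, and every ordered partition
    into independent sets refines some G-sequence. Hence a chain lies in the
    coloring complex iff some edge is contained in one of its blocks, and the
    edge-sphere of [e] is the order complex of the sets that do not split [e].
    Collapsing [e] (resp. [e] and [f]) to a point identifies this complex (resp.
    the intersection of two of them) with a truncated Boolean algebra.

    A point [x] of the order complex of the truncated Boolean algebra is
    determined by the vector [i |-> \sum_(S | i \in S) x S] of its heights up to
    an additive constant: the coordinate [x S] is the gap
    [max 0 (min_(i \in S, j \notin S) (w i - w j))] of the height vector [w].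
    Normalizing the height vectors gives the homeomorphism with the sphere. In
    these coordinates the [e]-sphere is the set of vectors constant on [e], the
    intersection with the sphere of [{i, j}] is the hyperplane [w i = w j], and
    the open halves are the convex sets [w i > w j] and [w i < w j]. *)

Lemma ltn_pred2 (m n : nat) : (m < n.-2)%N = (m.+1 < n.-1)%N.
Proof. by case: n => [|[|n]]. Qed.

Lemma chain_total (V : finType) (F : {set {set V}}) A B :
  is_chain F -> A \in F -> B \in F -> (A \subset B) || (B \subset A).
Proof. by move/'forall_implyP=> h AF BF; move/'forall_implyP: (h A AF) => /(_ B BF). Qed.

(** * Facets of one edge, and the edge-sphere as an order complex *)

Section EdgePerms.
Local Open Scope nat_scope.
Local Open Scope set_scope.
Variable d : nat.
Implicit Types (e f S T : {set 'I_d}) (b : d.-1.-tuple {set 'I_d}).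

Definition respects e S : bool := (e \subset S) || [disjoint e & S].

(** These are the vertices of the edge-sphere of [e]: by [edge_sphereE] the sphere is the order
    complex on them. *)
Definition edge_vertices e : {set {set 'I_d}} :=
  [set S in boolean_hat d | respects e S].

(** The letters of an [e]-permutation partition the vertex set; this is the letter that contributes
    [x]. *)
Definition letter_at e x : {set 'I_d} := if x \in e then e else [set x].

Definition prefix_union (b : seq {set 'I_d}) m : {set 'I_d} :=
  \bigcup_(L <- take m b) L.

Lemma respects_pair i j S : respects [set i; j] S = ((i \in S) == (j \in S)).
Proof.
rewrite /respects disjoints_subset !subUset !sub1set !inE.
by case: (i \in S); case: (j \in S).
Qed.

Lemma mem_letter_at e x : x \in letter_at e x.
Proof. by rewrite /letter_at; case: ifP => // _; rewrite inE. Qed.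

Lemma letter_at_in e x : letter_at e x \in letters e.
Proof.
rewrite /letter_at /letters !inE; case: ifP => xe; first by rewrite eqxx.
by apply/orP; right; apply: imset_f; rewrite inE xe.
Qed.

Lemma letter_atP e x L : L \in letters e -> x \in L -> L = letter_at e x.
Proof.
rewrite !inE => /orP[/eqP-> xe|/imsetP[y]]; first by rewrite /letter_at xe.
rewrite inE => ye -> /set1P->.
by rewrite /letter_at (negPf ye).
Qed.

Lemma letters_neq0 e L : e != set0 -> L \in letters e -> exists x, x \in L.
Proof.
move=> /set0Pn e0; rewrite !inE => /orP[/eqP->//|/imsetP[y _ ->]].
by exists y; rewrite inE.
Qed.

Lemma letter_at_subset e S x :
  respects e S -> (letter_at e x \subset S) = (x \in S).
Proof.
rewrite /letter_at /respects; case: ifP => xe; last by rewrite sub1set.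
case/orP=> [eS|dis]; first by rewrite eS (subsetP eS).
have xS : x \notin S by rewrite (disjointFr dis xe).
by rewrite (negPf xS); apply: contraNF xS => /subsetP/(_ _ xe).
Qed.

Lemma card_letters e : #|e| = 2 -> #|letters e| = d.-1.
Proof.
move=> e2; rewrite cardsU1 card_imset; last exact: set1_inj.
have := cardsC e; rewrite card_ord e2.
case: imsetP => [[x _ ex]|_]; first by move: e2; rewrite ex cards1.
by move=> /(congr1 predn).
Qed.

Section Word.
Variables (e : {set 'I_d}) (b : d.-1.-tuple {set 'I_d}).
Hypotheses (e2 : #|e| = 2) (bP : b \in edge_perms e).

Let e_neq0 : e != set0. Proof. by rewrite -card_gt0 e2. Qed.

Lemma mem_edge_perm L : (L \in b) = (L \in letters e).
Proof. by move: bP; rewrite inE => /perm_mem->; rewrite mem_enum. Qed.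

Lemma uniq_edge_perm : uniq b.
Proof. by move: bP; rewrite inE => /perm_uniq->; rewrite enum_uniq. Qed.

(** Since [letter_at e x] is the only letter containing [x], membership in a prefix union is a
    statement about one position in the word. *)
Lemma mem_prefix_union x m :
  (x \in prefix_union b m) = (index (letter_at e x) b < m).
Proof.
have Lb : letter_at e x \in (b : seq _) by rewrite mem_edge_perm letter_at_in.
rewrite /prefix_union bigcup_seq -(in_take _ Lb).
apply/bigcupP/idP => [[L Lb' xL]|]; last first.
  by exists (letter_at e x) => //; exact: mem_letter_at.
have := mem_take Lb'; rewrite mem_edge_perm => Ll.
by rewrite -(letter_atP Ll xL).
Qed.

Lemma prefix_union_subset m n :
  m <= n -> prefix_union b m \subset prefix_union b n.
Proof.
by move=> mn; apply/subsetP=> x; rewrite !mem_prefix_union => /leq_trans; apply.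
Qed.

Lemma prefix_union_proper m n :
  m < n <= d.-1 -> prefix_union b m \proper prefix_union b n.
Proof.
case/andP=> mn nd; rewrite properE prefix_union_subset 1?ltnW //=.
have mb : m < size b by rewrite size_tuple (leq_trans mn).
have Lb : nth e b m \in letters e by rewrite -mem_edge_perm mem_nth.
have [x xL] := letters_neq0 e_neq0 Lb.
apply/subsetPn; exists x; rewrite mem_prefix_union -(letter_atP Lb xL);
  by rewrite index_uniq ?uniq_edge_perm // ltnn.
Qed.

Lemma prefix_union0 : prefix_union b 0 = set0.
Proof. by rewrite /prefix_union take0 big_nil. Qed.

Lemma prefix_unionT : prefix_union b d.-1 = setT.
Proof.
apply/setP=> x; rewrite mem_prefix_union inE -{2}(size_tuple b) index_mem.
by rewrite mem_edge_perm letter_at_in.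
Qed.

Lemma prefix_union_respects m : respects e (prefix_union b m).
Proof.
have [im|im] := boolP (index e b < m); apply/orP; [left|right].
  by apply/subsetP=> x xe; rewrite mem_prefix_union /letter_at xe.
apply/pred0P=> x /=; apply/negP=> /andP[xe].
by rewrite mem_prefix_union /letter_at xe (negPf im).
Qed.

Lemma nth_edge_perm m : m < d.-1 ->
  nth set0 b m = prefix_union b m.+1 :\: prefix_union b m.
Proof.
move=> md; have mb : m < size b by rewrite size_tuple.
have Lb : nth set0 b m \in letters e by rewrite -mem_edge_perm mem_nth.
apply/setP=> x; rewrite inE !mem_prefix_union.
have xb : letter_at e x \in (b : seq _) by rewrite mem_edge_perm letter_at_in.
apply/idP/idP=> [/(letter_atP Lb)<-|].
  by rewrite index_uniq ?uniq_edge_perm // ltnn leqnn.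
rewrite -leqNgt ltnS => h; have <- : index (letter_at e x) b = m.
  by apply/eqP; rewrite eqn_leq andbC.
by rewrite nth_index // mem_letter_at.
Qed.

(** The members of the facet as a strictly increasing list; the empty and the full prefix are left
    out. *)
Definition prefix_seq (b' : d.-1.-tuple {set 'I_d}) : seq {set 'I_d} :=
  [seq prefix_union b' m.+1 | m <- iota 0 d.-2].

Lemma mem_facet_of b' : facet_of b' =i prefix_seq b'.
Proof.
move=> S; apply/imsetP/mapP => [[m _ ->]|[m]].
  by exists (val m) => //; rewrite mem_iota ltn_ord.
by rewrite mem_iota add0n => /= md ->; exists (Ordinal md).
Qed.

Lemma prefix_seq_sorted : sorted (fun A B : {set 'I_d} => A \proper B) (prefix_seq b).
Proof.
rewrite /prefix_seq sorted_map.
apply: (@sub_in_sorted _ [pred m | m < d.-2] ltn) (iota_ltn_sorted _ _).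
  move=> m n; rewrite !inE => md nd mn; apply: prefix_union_proper; have {}mn : m < n by [].
  by rewrite ltnS mn (leq_trans nd) // leq_pred.
by apply/allP=> m; rewrite mem_iota.
Qed.

Lemma prefix_seqE m : m < d.-2 -> nth set0 (prefix_seq b) m = prefix_union b m.+1.
Proof.
by move=> md; rewrite (nth_map 0) ?size_iota // nth_iota.
Qed.

Lemma card_facet_of : #|facet_of b| = d.-2.
Proof.
rewrite (eq_card (@mem_facet_of b)).
rewrite (card_uniqP _) ?size_map ?size_iota //.
apply: (@sorted_uniq _ (fun A B : {set 'I_d} => A \proper B)).
- by move=> ? ? ?; apply: proper_trans.
- by move=> A; rewrite properxx.
- exact: prefix_seq_sorted.
Qed.

Lemma facet_of_edge_vertices : facet_of b \in order_complex (edge_vertices e).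
Proof.
rewrite inE; apply/andP; split.
  apply/subsetP=> S /imsetP[m _ ->]; rewrite -/(prefix_union _ _) !inE.
  rewrite prefix_union_respects andbT.
  have md : m.+1 < d.-1 by rewrite -ltn_pred2.
  have := @prefix_union_proper 0 m.+1; rewrite prefix_union0 proper0.
  rewrite (ltnW md) /= => -> //=; apply: contraTneq (@prefix_union_proper m.+1 d.-1 _).
    by move=> ->; rewrite properE subsetT andbF.
  by rewrite md leqnn.
apply/'forall_implyP=> A /imsetP[m _ ->].
apply/'forall_implyP=> B /imsetP[n _ ->]; rewrite -!/(prefix_union _ _).
case/orP: (leq_total m n) => mn; apply/orP; [left|right];
  exact: prefix_union_subset.
Qed.

End Word.

(** A strictly increasing list is determined by the set of its members, and the letters are the
    differences of consecutive prefix unions. Allowing two edges serves both the injectivity for one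
    edge and the disjointness for two. *)
Lemma facet_of_inj2 e f b b' : #|e| = 2 -> #|f| = 2 ->
  b \in edge_perms e -> b' \in edge_perms f -> facet_of b = facet_of b' -> b = b'.
Proof.
move=> e2 f2 bP bP' eqF; apply: val_inj.
have eqs : prefix_seq b = prefix_seq b'.
  apply: (irr_sorted_eq _ _ (prefix_seq_sorted e2 bP) (prefix_seq_sorted f2 bP')).
  - by move=> ? ? ?; apply: proper_trans.
  - by move=> A; rewrite properxx.
  - by move=> S; rewrite -!mem_facet_of eqF.
have equ m : m <= d.-1 -> prefix_union b m = prefix_union b' m.
  case: m => [_|m]; first by rewrite !prefix_union0.
  rewrite leq_eqVlt => /orP[/eqP->|md].
    by rewrite (prefix_unionT bP) (prefix_unionT bP').
  have md' : m < d.-2 by rewrite ltn_pred2.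
  by rewrite -!prefix_seqE // eqs.
apply: (@eq_from_nth _ set0); first by rewrite !size_tuple.
move=> m; rewrite size_tuple => md.
by rewrite (nth_edge_perm bP) // (nth_edge_perm bP') // !equ // ltnW.
Qed.

(** A common facet comes from a single word, so [f] would be a letter of an [e]-permutation; but [e]
    is the only letter there with two elements. *)
Lemma edge_facets_disjoint e f : #|e| = 2 -> #|f| = 2 -> e != f ->
  [disjoint edge_facets e & edge_facets f].
Proof.
move=> e2 f2 ef; apply/pred0P=> F /=; apply/negP=> /andP[/imsetP[b bP ->]].
case/imsetP=> b' bP' eqF; have bb := facet_of_inj2 e2 f2 bP bP' eqF.
have := mem_edge_perm bP f; rewrite bb (mem_edge_perm bP') /letters setU11.
rewrite !inE eq_sym (negPf ef) => /esym/imsetP[x _ fx].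
by move: f2; rewrite fx cards1.
Qed.

Lemma card_edge_perms e : #|e| = 2 -> #|edge_perms e| = d.-1`!.
Proof.
move=> e2; rewrite -ffactnn; have := card_uniq_tuples d.-1 (mem (letters e)).
rewrite card_letters // => <-.
apply: eq_card => b; rewrite !inE; apply/idP/andP => [bP|[/allP ab ub]].
  rewrite (perm_uniq bP) enum_uniq; split=> //.
  by apply/allP=> L; rewrite (perm_mem bP) mem_enum.
apply: uniq_perm => //; first exact: enum_uniq.
have sb : {subset b <= enum (letters e)} by move=> L /ab; rewrite mem_enum.
by have [|] := uniq_min_size ub sb; rewrite // -cardE card_letters // size_tuple.
Qed.

(** For the inclusion from right to left, the letters are sorted so that every member of the chain
    becomes a prefix union. *)
Lemma edge_sphereE e : #|e| = 2 -> edge_sphere e = order_complex (edge_vertices e).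
Proof.
move=> e2; have e0 : e != set0 by rewrite -card_gt0 e2.
apply/setP=> F; rewrite [in LHS]inE; apply/existsP/idP.
  case=> T /andP[/imsetP[b bP ->] FT].
  have := facet_of_edge_vertices e2 bP; rewrite !inE => /andP[sT chT].
  rewrite (subset_trans FT sT) /=.
  apply/'forall_implyP=> A AF; apply/'forall_implyP=> B BF.
  by move/'forall_implyP/(_ A (subsetP FT _ AF))/'forall_implyP: chT => /(_ B (subsetP FT _ BF)).
rewrite inE => /andP[/subsetP sF chF].
(* The fewer members of the chain miss a letter, the earlier it enters the chain. *)
pose key (L : {set 'I_d}) := #|[set S in F | ~~ (L \subset S)]|.
pose le := relpre key leq.
have le_total : total le by move=> ? ?; apply: leq_total.
have sz : size (sort le (enum (letters e))) == d.-1.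
  by rewrite size_sort -cardE card_letters.
pose b := Tuple sz; have bP : b \in edge_perms e by rewrite inE perm_sort.
exists (facet_of b); rewrite imset_f //=; apply/subsetP=> S SF.
have := sF _ SF; rewrite !inE => /andP[/andP[S0 ST] Su].
pose p (L : {set 'I_d}) := L \subset S.
(* A member of [F] missing [L] lies inside [S], hence misses [L'] too; [S] itself misses only
   [L']. *)
have key_lt L L' : L \in letters e -> L' \in letters e -> p L -> ~~ p L' -> key L < key L'.
  move=> Ll Ll' LS L'S; apply: proper_card; apply/properP; split.
    apply/subsetP=> T; rewrite !inE => /andP[TF LT]; rewrite TF /=.
    apply: contra L'S => /subset_trans; apply.
    move/'forall_implyP/(_ T TF)/'forall_implyP/(_ S SF): chF.
    by case/orP=> // /(subset_trans LS); rewrite (negPf LT).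
  by exists S; rewrite !inE SF //= negbK.
have srt : sorted le b by apply: sort_sorted.
have pre L L' : L \in letters e -> L' \in letters e -> p L -> ~~ p L' ->
    index L b < index L' b.
  move=> Ll Ll' pL pL'; rewrite ltnNge; apply/negP => h.
  have := @sorted_leq_nth _ le _ _ e b srt (index L' b) (index L b).
  rewrite !inE !index_mem !(mem_edge_perm bP) Ll Ll' => /(_ _ _ isT isT h).
  rewrite !nth_index ?(mem_edge_perm bP) // => h'.
  suff : le L' L by rewrite /le /= leqNgt key_lt.
  by apply: h'; [move=> ? ? ?; apply: leq_trans | move=> ?; apply: leqnn].
have Ex x : x \in S = p (letter_at e x) by rewrite /p letter_at_subset.
(* The letters inside [S] come first in [b], so the position of the first letter outside [S] is the
   length of the prefix with union [S]. *)
pose m := find (predC p) b.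
have [y yS] : exists y, y \notin S.
  by apply/existsP; rewrite -negb_forall; apply: contra ST => /forallP h; apply/eqP/setP=> x; rewrite h inE.
have hasb : has (predC p) b.
  apply/hasP; exists (letter_at e y); first by rewrite (mem_edge_perm bP) letter_at_in.
  by rewrite /= -Ex.
have md : m < d.-1 by rewrite -(size_tuple b) -has_find.
have SE : S = prefix_union b m.
  apply/setP=> x; rewrite (mem_prefix_union bP) Ex.
  have xb : letter_at e x \in (b : seq _) by rewrite (mem_edge_perm bP) letter_at_in.
  apply/idP/idP => [px|/(before_find e)].
    rewrite -(index_uniq e _ (uniq_edge_perm bP) (i := m)) ?size_tuple //.
    apply: pre => //; rewrite -?(mem_edge_perm bP) //.
      by rewrite mem_nth // size_tuple.
    exact: (nth_find e hasb).
  by rewrite nth_index //= => /negbFE.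
have m0 : 0 < m.
  by rewrite lt0n; apply: contra S0 => /eqP m0; rewrite SE m0 prefix_union0.
rewrite mem_facet_of; apply/mapP; exists m.-1; last by rewrite prednK.
by rewrite mem_iota add0n /= ltn_pred2 prednK.
Qed.

End EdgePerms.

(** * Basic chains, and the coloring complex as the union of the edge-spheres *)

Section BasicChains.
Local Open Scope nat_scope.
Local Open Scope set_scope.
Variables (d : nat) (G : rel 'I_d).
Hypotheses (symG : symmetric G) (irrG : irreflexive G) (d_gt0 : 0 < d).
Implicit Types (pi : {perm 'I_d}) (C F : {set {set 'I_d}}).

Lemma mem_block pi m n k : (pi k \in block pi m n) = (m <= k < n).
Proof.
apply/imsetP/idP => [[k' h /perm_inj ->]|h]; first by move: h; rewrite inE.
by exists k => //; rewrite inE.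
Qed.

Lemma block_le0 pi n : n <= 0 -> block pi 0 n = set0.
Proof.
rewrite leqn0 => /eqP->; apply/setP=> x.
by rewrite -(permKV pi x) mem_block inE andbF.
Qed.

Lemma block_full pi : block pi 0 d = setT.
Proof. by apply/setP=> x; rewrite -(permKV pi x) mem_block inE ltn_ord. Qed.

Lemma block_diff pi m n : block pi m n = block pi 0 n :\: block pi 0 m.
Proof.
by apply/setP=> x; rewrite -(permKV pi x) inE !mem_block /= -leqNgt.
Qed.

Lemma block_proper pi m n : m < n <= d -> block pi 0 m \proper block pi 0 n.
Proof.
case/andP=> mn nd; apply/properP; split.
  apply/subsetP=> x; rewrite -(permKV pi x) !mem_block /=.
  by move=> /leq_trans; apply; apply: ltnW.
have md : m < d by apply: leq_trans nd.
by exists (pi (Ordinal md)); rewrite mem_block //= ltnn.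
Qed.

Lemma cuts_sorted pi : sorted ltn (cuts G pi).
Proof.
rewrite /cuts sorted_map; apply: sorted_filter; first by move=> ? ? ?; apply: ltn_trans.
by rewrite -sorted_map val_enum_ord iota_ltn_sorted.
Qed.

Lemma mem_cuts pi (k : 'I_d) : (val k \in cuts G pi) = is_cut G pi k.
Proof. by rewrite (mem_map val_inj) mem_filter mem_enum andbT. Qed.

Definition inner_cuts pi : seq nat := behead (cuts G pi).

Lemma cutsE pi : cuts G pi = 0 :: inner_cuts pi.
Proof.
have : 0 \in cuts G pi by rewrite (mem_cuts pi (Ordinal d_gt0)).
rewrite /inner_cuts; case E: (cuts G pi) (cuts_sorted pi) => [|a l] //= srt.
rewrite inE => /orP[/eqP<-//|l0].
by have /allP/(_ _ l0) := order_path_min ltn_trans srt.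
Qed.

Lemma inner_cuts_path pi : path ltn 0 (rcons (inner_cuts pi) d).
Proof.
have := cuts_sorted pi; rewrite cutsE /= rcons_path => ->/=.
have : last 0 (inner_cuts pi) \in cuts G pi by rewrite cutsE mem_last.
by case/mapP=> k _ ->; apply: ltn_ord.
Qed.

Lemma mem_inner_cuts pi k :
  (k \in inner_cuts pi) = (0 < k) && [exists i : 'I_d, (val i == k) && is_cut G pi i].
Proof.
have [->|k0] := posnP k.
  apply/negP=> h; have := inner_cuts_path pi; rewrite rcons_path => /andP[p _].
  by have /allP/(_ _ h) := order_path_min ltn_trans p.
have -> : (k \in inner_cuts pi) = (k \in cuts G pi).
  by rewrite cutsE inE eqn0Ngt k0.
apply/idP/existsP => [|[i /andP[/eqP<-]]]; last by rewrite mem_cuts.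
by case/mapP=> i; rewrite mem_filter => /andP[ci _] ->; exists i; rewrite eqxx.
Qed.

Lemma short_G_sequenceE pi :
  short_G_sequence G pi = pairmap (block pi) 0 (inner_cuts pi).
Proof.
rewrite /short_G_sequence /G_sequence size_map -map_take cutsE /=.
elim: (inner_cuts pi) 0 => [|b l IH] a //=.
by rewrite -IH; case: (l).
Qed.

Lemma pairmap_diff_block pi a (l : seq nat) :
  pairmap (fun A B : {set 'I_d} => B :\: A) (block pi 0 a) (map (block pi 0) l) =
  pairmap (block pi) a l.
Proof. by elim: l a => [|b l IH] a //=; rewrite IH -block_diff. Qed.

Lemma pairmap_block_inj pi a (l : seq nat) (s : seq {set 'I_d}) :
  path ltn a l -> path (fun A B : {set 'I_d} => A \proper B) (block pi 0 a) s ->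
  pairmap (block pi) a l = pairmap (fun A B : {set 'I_d} => B :\: A) (block pi 0 a) s ->
  s = map (block pi 0) l.
Proof.
elim: l a s => [|b l IH] a [|S s] //= /andP[ab pl] /andP[aS ps] [bS ls].
have SE : S = block pi 0 b.
  rewrite -(setID S (block pi 0 a)) -bS (setIidPr (proper_sub aS)).
  apply/setP=> x; rewrite -(permKV pi x) inE !mem_block /=.
  by case: ltnP => //= h; rewrite (ltn_trans h).
by rewrite (IH b s) -?SE.
Qed.

(** A chain starting from the empty set is determined by its successive differences. So the basic
    chain of [pi] consists of the initial segments of the word that end at its nonzero cuts. *)
Lemma basic_chainP C :
  reflect (exists pi, C = [set S in map (block pi 0) (inner_cuts pi)])
          (basic_chain G C).
Proof.
apply: (iffP existsP) => [[s /and3P[/eqP CE ps /existsP[pi /eqP sh]]]|[pi CE]].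
  have p0 := block_le0 pi (leqnn 0).
  exists pi; rewrite CE; suff sE : tval s = map (block pi 0) (inner_cuts pi).
    by apply/setP=> S; rewrite !inE -sE.
  apply: (@pairmap_block_inj pi 0); rewrite ?p0.
  - by have := inner_cuts_path pi; rewrite rcons_path => /andP[].
  - by move: ps; rewrite rcons_path => /andP[].
  - by rewrite -short_G_sequenceE sh.
have p0 := block_le0 pi (leqnn 0).
have pP : path (fun A B : {set 'I_d} => A \proper B) set0
    (rcons (map (block pi 0) (inner_cuts pi)) setT).
  rewrite -{1}p0 -(block_full pi) -map_rcons path_map.
  have := inner_cuts_path pi.
  apply: (@sub_in_path _ [pred m | m <= d]) => [m n _ nd mn|].
    by apply: block_proper; apply/andP; split.
  apply/allP => m; rewrite !inE mem_rcons inE => /or3P[/eqP->|/eqP->|] //.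
  by rewrite mem_inner_cuts => /andP[_ /existsP[i /andP[/eqP<- _]]] /=; apply/ltnW/ltn_ord.
(* [basic_chain] lists [C] by a tuple of length [#|C|], so the list must be free of repetitions. *)
have ut : uniq (map (block pi 0) (inner_cuts pi)).
  move: pP; rewrite rcons_path => /andP[pP _].
  have /andP[] // : uniq (set0 :: map (block pi 0) (inner_cuts pi)).
  apply: (@sorted_uniq _ (fun A B : {set 'I_d} => A \proper B)) => //.
    by move=> ? ? ?; apply: proper_trans.
  by move=> A; rewrite properxx.
have sz : size (map (block pi 0) (inner_cuts pi)) == #|C|.
  by rewrite CE cardsE; apply/eqP/esym/card_uniqP.
exists (Tuple sz); rewrite /= -CE eqxx pP /=; apply/existsP; exists pi.
by rewrite short_G_sequenceE -{1}p0 pairmap_diff_block.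
Qed.

Definition arc pi : rel 'I_d := [rel i j : 'I_d | (i < j) && G (pi i) (pi j)].

Lemma ell_witness pi k : exists i0 (s : seq 'I_d),
  [/\ path (arc pi) i0 s, last i0 s = k & size s = ell G pi k].
Proof.
pose P (r : 'I_d) := [exists i0 : 'I_d, exists s : r.-tuple 'I_d,
                   path (arc pi) i0 s && (last i0 s == k)].
have : #|P| > 0.
  apply/card_gt0P; exists (Ordinal d_gt0); apply/existsP; exists k.
  by apply/existsP; exists [tuple] => /=.
case/(eq_bigmax_cond (fun r : 'I_d => val r)) => r.
move=> /existsP[i0 /existsP[s /andP[p /eqP l]]] e.
exists i0, s; split=> //; rewrite size_tuple; symmetry; exact: e.
Qed.

(** Positions increase strictly along the path, so it has fewer than [d] steps and is among those
    over which [ell] takes the maximum. *)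
Lemma ell_ge pi k i0 (s : seq 'I_d) :
  path (arc pi) i0 s -> last i0 s = k -> size s <= ell G pi k.
Proof.
move=> p l; have us : uniq (i0 :: s).
  have : path ltn (val i0) (map val s).
    by rewrite path_map; apply: sub_path p => i j /andP[].
  move=> h; apply: (@map_uniq _ _ val).
  exact: (sorted_uniq ltn_trans ltnn (h : sorted ltn (map val (i0 :: s)))).
have sz : size s < d by have := max_card (mem (i0 :: s)); rewrite (card_uniqP us) card_ord.
apply: (@leq_bigmax_cond _ _ (fun r : 'I_d => val r) (Ordinal sz)).
apply/existsP; exists i0; apply/existsP; exists (in_tuple s).
by rewrite p l eqxx.
Qed.

Lemma ell_lt pi (p q : 'I_d) : p < q -> G (pi p) (pi q) -> ell G pi p < ell G pi q.
Proof.
move=> pq Gpq; have [i0 [s [ps ls <-]]] := ell_witness pi p.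
rewrite -(size_rcons s q); apply: (@ell_ge pi q i0); last by rewrite last_rcons.
by rewrite rcons_path ps ls /arc /= pq.
Qed.

(* Between two cuts [ell] is weakly decreasing, whereas it increases along
   every edge: the letters between two cuts form an independent set. *)
Lemma basic_chain_splits C i j : basic_chain G C -> G i j ->
  exists2 S, S \in C & ~~ respects [set i; j] S.
Proof.
case/basic_chainP=> pi -> Gij.
suff H (p q : 'I_d) : p < q -> G (pi p) (pi q) ->
    exists2 S, S \in [set S in map (block pi 0) (inner_cuts pi)] &
      ~~ respects [set pi p; pi q] S.
  have [p pE] : exists p, i = pi p by exists (pi^-1%g i); rewrite permKV.
  have [q qE] : exists q, j = pi q by exists (pi^-1%g j); rewrite permKV.
  rewrite pE qE in Gij *; case: (ltngtP p q) => pq; first exact: H.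
    by rewrite setUC; apply: H => //; rewrite symG.
  by rewrite (val_inj pq) irrG in Gij.
move=> pq Gpq.
have [/existsP[k /and3P[pk kq kc]]|nc] := boolP [exists k : 'I_d, [&& p < k, k <= q & is_cut G pi k]].
  exists (block pi 0 k); first rewrite inE map_f // mem_inner_cuts.
    by rewrite (leq_ltn_trans _ pk) //; apply/existsP; exists k; rewrite eqxx.
  by rewrite respects_pair !mem_block /= pk ltnNge kq.
suff : ell G pi q <= ell G pi p by rewrite leqNgt ell_lt.
have [n qE] : exists n, val q = p + n by exists (q - p); rewrite subnKC // ltnW.
have H m (k : 'I_d) : m <= n -> val k = p + m -> ell G pi k <= ell G pi p.
  elim: m k => [|m IH] k mn kE; first by rewrite (_ : k = p) //; apply: val_inj; rewrite kE addn0.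
  have jd : p + m < d by rewrite (leq_ltn_trans _ (ltn_ord k)) // kE leq_add2l.
  apply: leq_trans (IH (Ordinal jd) (ltnW mn) (erefl _)).
  rewrite leqNgt; apply: contra nc => lt; apply/existsP; exists k.
  rewrite kE qE leq_add2l mn -[X in X < _]addn0 ltn_add2l /=.
  apply/orP; right; apply/existsP; exists (Ordinal jd).
  by rewrite /= kE addnS eqxx lt.
exact: (H n).
Qed.

(** Comparison of leading digits in base [M]; it decodes [sort_key]. *)
Lemma leq_mixed M x y x' y' : y' < M -> x * M + y <= x' * M + y' -> x <= x'.
Proof.
move=> yM h; rewrite -ltnS -(ltn_pmul2r (leq_trans _ yM)) // mulSn.
apply: leq_ltn_trans (leq_addr y _) _; apply: leq_ltn_trans h _.
by rewrite addnC ltn_add2r.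
Qed.

(** * A permutation whose G-sequence is refined by a given ordered partition into independent
    sets *)

Section Refine.
Variable F : {set {set 'I_d}}.
Hypothesis chF : is_chain F.

(** This numbers, in increasing order, the blocks into which the chain [F] cuts the vertex set: two
    letters get the same value exactly when no member of [F] separates them. *)
Definition blk (v : 'I_d) : nat := #|[set S in F | v \notin S]|.

Lemma blk_lt S u v : S \in F -> u \in S -> v \notin S -> blk u < blk v.
Proof.
move=> SF uS vS; apply: proper_card; apply/properP; split.
  apply/subsetP=> T; rewrite !inE => /andP[TF uT]; rewrite TF /=.
  case/orP: (chain_total chF SF TF) => [ST|/subsetP TS].
    by rewrite (subsetP ST _ uS) in uT.
  by apply: contra vS => /TS.
by exists S; rewrite !inE SF //= uS.
Qed.

Lemma blk_ltP u v : blk u < blk v -> exists S, [/\ S \in F, u \in S & v \notin S].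
Proof.
rewrite ltnNge => h.
have /subsetPn[S] : ~~ ([set S in F | v \notin S] \subset [set S in F | u \notin S]).
  by apply: contra h; apply: subset_leq_card.
by rewrite !inE => /andP[SF vS]; rewrite SF negbK => uS; exists S.
Qed.

Definition blk_arc : rel 'I_d := [rel u v | (blk u < blk v) && G u v].

(** The counterpart of [ell] for letters instead of positions, with arcs directed by the order of
    the blocks. It can be defined before the permutation is chosen, and [ell_sorting] identifies it
    with [ell] afterwards. *)
Definition level (v : 'I_d) : nat :=
  \max_(r < d | [exists v0 : 'I_d, exists s : r.-tuple 'I_d,
                   path blk_arc v0 s && (last v0 s == v)]) r.

Lemma level_le v : level v <= d.
Proof. by apply/bigmax_leqP => r _; apply: ltnW. Qed.

(** A lexicographic order written in mixed radix: increasing block, then decreasing level, then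
    decreasing label. The lower digits are at most [d] and at most [d.-1], whence the bases [d.+1]
    and [d]. *)
Definition sort_key (v : 'I_d) : nat :=
  (blk v * d.+1 + (d - level v)) * d + (d.-1 - v).

Lemma sort_key_blk u v : sort_key u <= sort_key v -> blk u <= blk v.
Proof.
have dd (w : 'I_d) : d.-1 - w < d by rewrite (leq_ltn_trans (leq_subr _ _)) // prednK.
by move/leq_mixed => /(_ (dd _)) /leq_mixed; apply; rewrite ltnS leq_subr.
Qed.

Lemma sort_key_level u v :
  sort_key u <= sort_key v -> blk u = blk v -> level v <= level u.
Proof.
have dd (w : 'I_d) : d.-1 - w < d by rewrite (leq_ltn_trans (leq_subr _ _)) // prednK.
move/leq_mixed => /(_ (dd _)) h e; move: h; rewrite e leq_add2l.
by rewrite leq_sub2lE // level_le.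
Qed.

Lemma sort_key_label u v :
  sort_key u <= sort_key v -> blk u = blk v -> level u = level v -> v <= u.
Proof.
move=> h e e'; move: h; rewrite /sort_key e e' leq_add2l leq_sub2lE //.
by rewrite -ltnS prednK.
Qed.

Lemma sort_key_inj : injective sort_key.
Proof.
move=> u v e; have h : sort_key u <= sort_key v by rewrite e.
have h' : sort_key v <= sort_key u by rewrite e.
have eb : blk u = blk v by apply/eqP; rewrite eqn_leq !sort_key_blk.
have el : level u = level v by apply/eqP; rewrite eqn_leq !sort_key_level.
by apply/val_inj/eqP; rewrite eqn_leq !sort_key_label.
Qed.

Lemma sorting_perm : exists pi, forall i j : 'I_d, (i <= j) = (sort_key (pi i) <= sort_key (pi j)).
Proof.
(* The number of smaller keys is the position of a letter in the sorted word; the permutation is the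
   inverse of this bijection. *)
pose rk v := #|[set w | sort_key w < sort_key v]|.
have rk_lt v : rk v < d.
  rewrite -[X in _ < X](card_ord d) -cardsT; apply: proper_card; apply/properP.
  split; first exact: subsetT.
  by exists v; rewrite ?inE ?ltnn.
pose r v := Ordinal (rk_lt v).
have rk_leq u v : sort_key u <= sort_key v -> rk u <= rk v.
  by move=> uv; apply: subset_leq_card; apply/subsetP=> w; rewrite !inE => /leq_trans; apply.
have rk_ltn u v : sort_key u < sort_key v -> rk u < rk v.
  move=> uv; apply: proper_card; apply/properP; split.
    by apply/subsetP=> w; rewrite !inE => /ltn_trans; apply.
  by exists u; rewrite !inE ?ltnn.
have rkE u v : (rk u <= rk v) = (sort_key u <= sort_key v).
  by apply/idP/idP=> [|/rk_leq//]; apply: contraTT; rewrite -!ltnNge => /rk_ltn.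
have r_inj : injective r.
  move=> u v [e]; apply/sort_key_inj/eqP; rewrite eqn_leq -!rkE.
  by rewrite e leqnn.
exists (perm r_inj)^-1%g => i j; rewrite -rkE.
by rewrite -{1}(permKV (perm r_inj) i) -{1}(permKV (perm r_inj) j) !permE.
Qed.

Hypothesis splitF : forall i j, G i j -> exists2 S, S \in F & ~~ respects [set i; j] S.

Lemma blk_neq u v : G u v -> blk u != blk v.
Proof.
move=> /splitF[S SF]; rewrite respects_pair.
case uS: (u \in S); case vS: (v \in S) => //= _.
  by rewrite neq_ltn (blk_lt SF uS) // vS.
by rewrite neq_ltn (blk_lt SF vS) ?uS ?orbT.
Qed.

(** By [splitF] the ends of an edge lie in different blocks. As [pi] lists the blocks in order, it
    carries the arcs between positions to the arcs between letters, in both directions. *)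
Lemma ell_sorting pi k :
  (forall i j : 'I_d, (i <= j) = (sort_key (pi i) <= sort_key (pi j))) ->
  ell G pi k = level (pi k).
Proof.
move=> srt.
have arcE : relpre pi blk_arc =2 arc pi.
  move=> i j; rewrite /arc /blk_arc /=; have [Gij|] := boolP (G _ _); rewrite ?andbF //.
  rewrite !andbT; apply/idP/idP => [h|].
    by rewrite ltnNge srt; apply: contraL h => /sort_key_blk; rewrite -leqNgt.
  by move=> /ltnW; rewrite srt => /sort_key_blk; rewrite leq_eqVlt (negPf (blk_neq Gij)).
apply: eq_bigl => r; apply/existsP/existsP => -[i0 /existsP[s /andP[p /eqP l]]].
  exists (pi i0); apply/existsP; exists [tuple of map pi s].
  by rewrite /= path_map last_map l eqxx (eq_path arcE) p.
exists (pi^-1%g i0); apply/existsP; exists [tuple of map (pi^-1)%g s].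
rewrite /= last_map l permK eqxx andbT -(eq_path arcE) -path_map -map_comp.
rewrite permKV (eq_map (g := id)) ?map_id //.
by move=> x /=; rewrite permKV.
Qed.

(* Listing the letters block by block, each block by decreasing level and then
   by decreasing label, every cut falls between two blocks. *)
Lemma basic_subchain : exists2 C, basic_chain G C & C \subset F.
Proof.
have [pi srt] := sorting_perm.
exists [set S in map (block pi 0) (inner_cuts pi)].
  by apply/basic_chainP; exists pi.
apply/subsetP=> S; rewrite inE => /mapP[n]; rewrite mem_inner_cuts.
case/andP=> n0 /existsP[k /andP[/eqP kn kc]] ->.
move: kc; rewrite /is_cut -[(k : nat)]/(val k) kn eqn0Ngt n0 /=.
case/existsP=> j /andP[/eqP jn]; rewrite !(ell_sorting _ srt) => cutk.
have jk : sort_key (pi j) <= sort_key (pi k) by rewrite -srt -[k : nat]/(val k) kn -jn.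
have : blk (pi j) < blk (pi k).
  rewrite ltn_neqAle (sort_key_blk jk) andbT; apply/negP => /eqP e.
  case/orP: cutk; first by rewrite ltnNge (sort_key_level jk e).
  case/andP=> /eqP el; by rewrite ltnNge (sort_key_label jk e el).
(* [T] contains the letter just before the cut and not the one just after it. Since [blk] increases
   weakly along the word, [T] is the whole initial segment. *)
case/blk_ltP=> T [TF jT kT]; suff -> : block pi 0 n = T by [].
apply/setP=> x; rewrite -(permKV pi x); set p := (pi^-1)%g x; rewrite mem_block /=.
apply/idP/idP => [pn|].
  apply: contraLR (isT) => pT; have := blk_lt TF jT pT; rewrite ltnNge sort_key_blk //.
  by rewrite -srt -ltnS jn.
apply: contraLR; rewrite -leqNgt -kn srt => /sort_key_blk h.
by apply: contraL h => pT; rewrite -ltnNge (blk_lt TF).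
Qed.

End Refine.

Lemma edgesP e : reflect (exists2 p : 'I_d * 'I_d, G p.1 p.2 & e = [set p.1; p.2])
  (e \in edges G).
Proof. by apply: (iffP imsetP) => -[p Gp ->]; exists p => //; move: Gp; rewrite inE. Qed.

Lemma card_edge e : e \in edges G -> #|e| = 2.
Proof.
case/edgesP=> -[i j] /= Gij ->; rewrite cards2.
by case: eqP Gij => // ->; rewrite irrG.
Qed.

(** If a chain splits every edge, [basic_subchain] finds a basic chain inside it. Conversely a basic
    chain splits every edge, so it cannot lie in a chain that leaves some edge [e] unsplit. *)
Lemma coloring_complexE : coloring_complex G = \bigcup_(e in edges G) edge_sphere e.
Proof.
apply/setP=> F; rewrite inE; apply/andP/bigcupP => [[]|[e eG]].
  rewrite inE => /andP[sF chF] /forallP nb.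
  have [/existsP[e /andP[eG /forallP he]]|/existsPn h] :=
    boolP [exists e, (e \in edges G) && [forall S, (S \in F) ==> respects e S]].
    exists e => //; rewrite edge_sphereE ?card_edge // inE chF andbT.
    apply/subsetP=> S SF; rewrite inE (subsetP sF) //=.
    exact: (implyP (he S)).
  have [i j Gij|C bC CF] := basic_subchain chF.
    have := h [set i; j]; rewrite negb_and => /orP[|/forallPn[S]].
      by move=> /edgesP[]; exists (i, j).
    by rewrite negb_imply => /andP[SF nS]; exists S.
  by have := nb C; rewrite bC CF.
rewrite edge_sphereE ?card_edge // inE => /andP[/subsetP sF chF]; split.
  rewrite inE chF andbT; apply/subsetP=> S /sF; by rewrite inE => /andP[].
apply/forallP=> C; apply/implyP=> bC; apply/negP=> /subsetP CF.
case/edgesP: eG sF => -[i j] /= Gij -> sF.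
have [S /CF/sF] := basic_chain_splits bC Gij.
by rewrite inE => /andP[_ ->].
Qed.

Lemma mem_coloring_complex F :
  (F \in coloring_complex G) =
  [exists T in \bigcup_(e in edges G) edge_facets e, F \subset T].
Proof.
rewrite coloring_complexE; apply/bigcupP/existsP => [[e eG]|[T /andP[/bigcupP[e eG Te FT]]]].
  rewrite inE => /existsP[T /andP[Te FT]]; exists T; rewrite FT andbT.
  by apply/bigcupP; exists e.
by exists e => //; rewrite inE; apply/existsP; exists T; rewrite Te.
Qed.

Lemma card_edge_facet T : T \in \bigcup_(e in edges G) edge_facets e -> #|T| = d.-2.
Proof.
case/bigcupP=> e /card_edge e2 /imsetP[b bP ->].
exact: (card_facet_of e2 bP).
Qed.

(** All edge facets have [d.-2] members, so none is properly contained in another. *)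
Lemma facets_coloring_complex :
  facets (coloring_complex G) = \bigcup_(e in edges G) edge_facets e.
Proof.
apply/setP=> T; rewrite inE; apply/maxsetP/idP => [[]|TG].
  rewrite mem_coloring_complex => /existsP[T' /andP[T'G TT']] max.
  suff <- : T' = T by [].
  by apply: max => //; rewrite mem_coloring_complex; apply/existsP; exists T'; rewrite T'G subxx.
split; first by rewrite mem_coloring_complex; apply/existsP; exists T; rewrite TG subxx.
move=> F; rewrite mem_coloring_complex => /existsP[T' /andP[T'G FT']] TF.
have TT' := subset_trans TF FT'.
apply/eqP; rewrite eq_sym eqEcard TF (leq_trans (subset_leq_card FT')) //.
by rewrite (card_edge_facet TG) (card_edge_facet T'G).
Qed.

Lemma complex_dim_coloring_complex : edges G != set0 ->
  complex_dim (coloring_complex G) = (d.-2%:Z - 1)%R.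
Proof.
case/set0Pn=> e eG; rewrite /complex_dim; congr (_ - 1)%R; congr (_ : nat)%:Z%R.
have e2 := card_edge eG.
have [b bP] : exists b, b \in edge_perms e.
  by apply/set0Pn; rewrite -card_gt0 card_edge_perms // fact_gt0.
apply/eqP; rewrite eqn_leq; apply/andP; split.
  apply/bigmax_leqP => F; rewrite mem_coloring_complex => /existsP[T /andP[TG FT]].
  by rewrite -(card_edge_facet TG) subset_leq_card.
have TG : facet_of b \in \bigcup_(e in edges G) edge_facets e.
  by apply/bigcupP; exists e; rewrite ?imset_f.
rewrite -(card_edge_facet TG).
apply: (@leq_bigmax_cond _ _ (fun F : {set {set 'I_d}} => #|F|)).
by rewrite mem_coloring_complex; apply/existsP; exists (facet_of b); rewrite TG subxx.
Qed.

End BasicChains.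

(** * Truncated Boolean algebras obtained by collapsing edges *)

Section Quotients.
Local Open Scope nat_scope.
Local Open Scope set_scope.

Lemma order_complexI (V : finType) (P Q : {set {set V}}) :
  order_complex P :&: order_complex Q = order_complex (P :&: Q).
Proof.
by apply/setP=> F; rewrite !inE subsetI andbACA andbb.
Qed.

Lemma is_complex_order_complex (V : finType) (P : {set {set V}}) :
  is_complex (order_complex P).
Proof.
apply/'forall_implyP=> F; rewrite inE => /andP[FP chF].
apply/'forall_implyP=> F' F'F; rewrite inE (subset_trans F'F) //=.
apply/'forall_implyP=> A AF; apply/'forall_implyP=> B BF.
by rewrite (chain_total chF) ?(subsetP F'F).
Qed.

Lemma set1_order_complex (V : finType) (P : {set {set V}}) S :
  ([set S] \in order_complex P) = (S \in P).
Proof.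
rewrite inE sub1set; case: (S \in P) => //=.
by apply/'forall_implyP=> A /set1P->; apply/'forall_implyP=> B /set1P->; rewrite subxx.
Qed.

Lemma barycentric_simplex_boundary n :
  barycentric_subdivision (simplex_boundary n) = order_complex (boolean_hat n).
Proof.
by congr order_complex; apply/setP=> S; rewrite !inE.
Qed.

Lemma order_complex_iso (V W : finType) (P : {set {set V}}) (Q : {set {set W}})
    (f : {set V} -> {set W}) (g : {set W} -> {set V}) :
    {in P, forall S, f S \in Q} -> {in Q, forall T, g T \in P} ->
    {in P, cancel f g} -> {in Q, cancel g f} ->
    {homo f : A B / A \subset B} -> {homo g : A B / A \subset B} ->
  complex_iso (order_complex P) (order_complex Q).
Proof.
move=> fPQ gQP fK gK fm gm; exists f; split.
  move=> S T SP TP; apply: (can_in_inj fK); rewrite -set1_order_complex.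
    exact: SP.
  exact: TP.
apply/setP=> F; apply/imsetP/idP => [[E]|].
  rewrite !inE => /andP[/subsetP EP chE] ->; apply/andP; split.
    by apply/subsetP=> _ /imsetP[S SE ->]; rewrite fPQ ?EP.
  apply/'forall_implyP=> _ /imsetP[A AE ->]; apply/'forall_implyP=> _ /imsetP[B BE ->].
  by case/orP: (chain_total chE AE BE) => /fm ->; rewrite ?orbT.
rewrite inE => /andP[/subsetP FQ chF]; exists (g @: F).
  rewrite inE; apply/andP; split.
    by apply/subsetP=> _ /imsetP[S SE ->]; rewrite gQP ?FQ.
  apply/'forall_implyP=> _ /imsetP[A AE ->]; apply/'forall_implyP=> _ /imsetP[B BE ->].
  by case/orP: (chain_total chF AE BE) => /gm ->; rewrite ?orbT.
apply/setP=> T; rewrite -imset_comp; apply/idP/imsetP => [TF|[S SF ->]] /=.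
  by exists T => //=; rewrite gK ?FQ.
by rewrite gK ?FQ.
Qed.

Variable d : nat.
Implicit Types (S : {set 'I_d}) (rho : 'I_d -> 'I_d).

(** [P] consists of the nonempty proper unions of fibres of [rho]. Image and preimage under the
    quotient map onto the [n] fibres are inverse to each other on such sets. *)
Lemma quotient_iso rho (P : {set {set 'I_d}}) n :
    #|rho @: [set: 'I_d]| = n ->
    (forall S, reflect (S \in boolean_hat d /\
       forall x y, rho x = rho y -> (x \in S) = (y \in S)) (S \in P)) ->
  complex_iso (order_complex P) (order_complex (boolean_hat n)).
Proof.
set A := rho @: _ => An PP.
have qP x : index (rho x) (enum A) < n.
  by rewrite -An cardE index_mem mem_enum imset_f.
(* [q] is the quotient map: it numbers each fibre by the rank of its value in the image of [rho]. *)
pose q x := Ordinal (qP x).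
have qE x y : q x = q y -> rho x = rho y.
  case=> e; rewrite -(nth_index x (_ : rho x \in enum A)) ?mem_enum ?imset_f //.
  by rewrite e nth_index // mem_enum imset_f.
have qS y : exists x, q x = y.
  have sy : y < size (enum A) by rewrite -cardE An.
  have [x0 _] : exists x0, x0 \in enum A.
    by case: (enum A) sy => // a l _; exists a; rewrite inE eqxx.
  have : nth x0 (enum A) y \in A by rewrite -mem_enum mem_nth.
  case/imsetP=> x _ e; exists x; apply: val_inj => /=.
  by rewrite -e index_uniq ?enum_uniq.
have qrho x y : rho x = rho y -> q x = q y by move=> e; apply: val_inj; rewrite /= e.
have preK (T : {set 'I_n}) : q @: (q @^-1: T) = T.
  apply/setP=> y; apply/imsetP/idP => [[x] |yT]; first by rewrite inE => ? ->.
  by have [x qx] := qS y; exists x; rewrite ?inE qx.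
apply: (@order_complex_iso _ _ _ _ (fun S => q @: S) (fun T => q @^-1: T)).
- move=> S /PP[]; rewrite !inE => /andP[/set0Pn[x xS] ST] sat; apply/andP; split.
    by apply/set0Pn; exists (q x); apply: imset_f.
  apply: contra ST => /eqP qT; apply/eqP/setP=> y; rewrite inE.
  have : q y \in q @: S by rewrite qT in_setT.
  by case/imsetP=> z zS /qE /sat ->.
- move=> T; rewrite !inE => /andP[/set0Pn[y yT] TT]; apply/PP; split.
    rewrite !inE; apply/andP; split.
      by have [x qx] := qS y; apply/set0Pn; exists x; rewrite inE qx.
    apply: contra TT => /eqP e; apply/eqP/setP=> z; rewrite inE.
    by have [x <-] := qS z; have := in_setT x; rewrite -e inE.
  by move=> x z /qrho e; rewrite !inE e.
- move=> S /PP[_ sat]; apply/setP=> x; rewrite inE.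
  apply/imsetP/idP => [[z zS /qE /sat ->] //|xS]; by exists x.
- by move=> T _; apply: preK.
- by move=> S T ST; apply: imsetS.
- by move=> S T ST; apply: preimsetS.
Qed.

Definition merge (i j x : 'I_d) : 'I_d := if x == j then i else x.

Arguments merge : simpl never.

Lemma merge_neq i j x : i != j -> merge i j x != j.
Proof. by rewrite /merge; case: ifPn. Qed.

Lemma merge_id i j x : x != j -> merge i j x = x.
Proof. by rewrite /merge => /negPf->. Qed.

Lemma merge_eq i j : merge i j i = merge i j j.
Proof. by rewrite /merge eqxx; case: eqP. Qed.

Lemma mem_merge i j x S : (i \in S) = (j \in S) -> (merge i j x \in S) = (x \in S).
Proof. by rewrite /merge; case: eqP => // ->. Qed.

Lemma mem_edge_vertices e S :
  (S \in edge_vertices e) = (S \in boolean_hat d) && respects e S.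
Proof. by rewrite !inE. Qed.

Lemma edge_vertices_iso (i j : 'I_d) : i != j ->
  complex_iso (order_complex (edge_vertices [set i; j]))
    (order_complex (boolean_hat d.-1)).
Proof.
move=> ij; apply: (@quotient_iso (merge i j)).
  rewrite (_ : _ @: _ = [set~ j]) ?cardsC1 ?card_ord //.
  apply/setP=> x; rewrite !inE; apply/imsetP/idP => [[y _ ->]|xj].
    exact: merge_neq.
  by exists x; rewrite ?merge_id.
move=> S; rewrite mem_edge_vertices respects_pair; apply: (iffP andP) => [[-> /eqP e]|[-> h]]; split=> //.
  by move=> x y exy; rewrite -(mem_merge x e) exy mem_merge.
by apply/eqP/h/merge_eq.
Qed.

(** After the first edge is collapsed, the second becomes the pair [k'], [l'], still with distinct
    ends because the edges differ; collapsing it as well leaves [d.-2] points. This treats disjoint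
    and adjacent edges alike. *)
Lemma edge_verticesI_iso (i j k l : 'I_d) : i != j -> k != l -> [set i; j] != [set k; l] ->
  complex_iso (order_complex (edge_vertices [set i; j] :&: edge_vertices [set k; l]))
    (order_complex (boolean_hat d.-2)).
Proof.
move=> ij kl ef; pose k' := merge i j k; pose l' := merge i j l.
have kl' : k' != l'.
  apply: contraNneq ef; rewrite /k' /l' /merge.
  case: (eqVneq k j) => [kj|_]; case: (eqVneq l j) => [lj|_] e.
  - by rewrite kj lj eqxx in kl.
  - by rewrite kj e setUC.
  - by rewrite lj e.
  - by rewrite e eqxx in kl.
have k'j : k' != j by apply: merge_neq.
have l'j : l' != j by apply: merge_neq.
apply: (@quotient_iso (merge k' l' \o merge i j)).
  rewrite (_ : _ @: _ = ~: [set j; l']).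
    by have := cardsC [set j; l']; rewrite card_ord cards2 eq_sym l'j => /(congr1 (fun n => n.-2)).
  apply/setP=> x; rewrite !inE negb_or; apply/imsetP/andP => [[y _ ->]|[xj xl]] /=.
    split; last exact: merge_neq.
    by rewrite /merge -/(merge i j y); case: ifP => // _; apply: merge_neq.
  by exists x; rewrite /= ?inE ?(merge_id _ xj) ?merge_id.
move=> S; rewrite in_setI !mem_edge_vertices !respects_pair; apply: (iffP andP).
  move=> [/andP[-> /eqP e] /andP[_ /eqP f]]; split=> // x y exy.
  have e' : (k' \in S) = (l' \in S) by rewrite !mem_merge.
  rewrite -(mem_merge x e) -(mem_merge _ e') -[merge _ _ _]/((merge k' l' \o merge i j) x).
  by rewrite exy /= !mem_merge.
case=> -> h; split; rewrite /=; apply/eqP/h => /=; first by rewrite merge_eq.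
by rewrite -/k' -/l' merge_eq.
Qed.

End Quotients.

(** * The correspondence between height vectors and weights on chains *)

Section Gaps.
Local Open Scope ring_scope.
Local Open Scope set_scope.
Variables (R : realType) (n : nat).
Implicit Types (x : {set 'I_n} -> R) (w : 'I_n -> R) (S T : {set 'I_n}) (i j : 'I_n).

Definition height x i : R := \sum_(S : {set 'I_n} | i \in S) x S.

(** Barycentric coordinates on the order complex of [boolean_hat n] without the condition that they
    sum to 1, that is, points of the cone over its realization. *)
Definition chainlike x : Prop :=
  [/\ forall S, 0 <= x S,
      forall S, x S != 0 -> S \in boolean_hat n &
      forall S T, x S != 0 -> x T != 0 -> (S \subset T) || (T \subset S)].

(* The idle value of the iterated minimum bounds all the differences. *)
Definition gap w S : R :=
  if S \in boolean_hat n then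
    Num.max 0 (\big[Num.min/ \sum_(p : 'I_n * 'I_n) `|w p.1 - w p.2|]_(p : 'I_n * 'I_n |
      (p.1 \in S) && (p.2 \notin S)) (w p.1 - w p.2))
  else 0.

Lemma gap_ge0 w S : 0 <= gap w S.
Proof. by rewrite /gap; case: ifP => // _; rewrite le_max lexx. Qed.

Lemma boolean_hatP S :
  reflect ((exists i, i \in S) /\ (exists j, j \notin S)) (S \in boolean_hat n).
Proof.
rewrite inE; apply: (iffP andP) => [[/set0Pn S0 ST]|[/set0Pn-> [j jS]]]; split=> //.
  by apply/existsP; rewrite -negb_forall; apply: contra ST => /forallP h; apply/eqP/setP=> x; rewrite h inE.
by apply: contraNneq jS => ->; rewrite inE.
Qed.

(** The minimum of the differences splits into a minimum over [S] and a maximum over its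
    complement. *)
Lemma gap_attained w S : S \in boolean_hat n -> exists i j,
  [/\ i \in S, j \notin S, forall k, k \in S -> w i <= w k,
      forall k, k \notin S -> w k <= w j & gap w S = Num.max 0 (w i - w j)].
Proof.
move=> Sh; have [[i0 i0S] [j0 j0S]] := boolean_hatP _ Sh.
have [i iS iP] := @arg_minP _ _ _ i0 [pred i | i \in S] w i0S.
have [j jS jP] := @arg_maxP _ _ _ j0 [pred j | j \notin S] w j0S.
exists i, j; split=> //; rewrite /gap Sh; congr Num.max.
apply/eqP; rewrite eq_le; apply/andP; split.
  by apply: (@bigmin_le_cond _ _ _ _ (i, j)); apply/andP.
apply/bigmin_geP; split.
  rewrite (bigD1 (i, j)) //= (le_trans (ler_norm _)) // lerDl.
  by apply: sumr_ge0 => p _.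
by case=> k l /andP[/= kS lS]; apply: lerB; [apply: iP|apply: jP].
Qed.

Lemma height_diff x i j :
  height x i - height x j =
  \sum_(S : {set 'I_n} | (i \in S) && (j \notin S)) x S -
  \sum_(S : {set 'I_n} | (j \in S) && (i \notin S)) x S.
Proof.
rewrite /height (bigID (fun S : {set 'I_n} => j \in S)) /=.
rewrite [X in _ - X](bigID (fun S : {set 'I_n} => i \in S)) /=.
under [X in _ - (X + _)]eq_bigl do rewrite andbC.
by rewrite opprD addrACA subrr add0r.
Qed.

Lemma height_eq x i j : (forall S, x S != 0 -> (i \in S) = (j \in S)) ->
  height x i = height x j.
Proof.
move=> xij; apply/eqP; rewrite -subr_eq0 height_diff !big1 ?subrr // => S Sij;
  apply/eqP; apply: contraT => /xij h; move: Sij; by rewrite h; case: (j \in S).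
Qed.

(** A set containing [j] and not [i] is incomparable with [S], hence has weight 0, and the negative
    part of the height difference vanishes. *)
Lemma height_diff_ge x i j S : chainlike x -> x S != 0 -> i \in S -> j \notin S ->
  x S <= height x i - height x j.
Proof.
case=> x0 xh xc xS iS jS; rewrite height_diff [X in _ - X]big1 ?subr0.
  rewrite (bigD1 S) ?iS //= lerDl; apply: sumr_ge0 => T _; exact: x0.
move=> T /andP[jT iT]; apply/eqP; apply: contraT => xT.
case/orP: (xc _ _ xS xT) => /subsetP h; first by rewrite h in iT.
by rewrite h in jS.
Qed.

(** This is the uniqueness half: the height differences determine the weights. Both cases compare
    heights at a lowest element [i] of [S] and a highest element [j] outside it. *)
Lemma gap_eq x w : chainlike x ->
  (forall i j, w i - w j = height x i - height x j) -> gap w =1 x.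
Proof.
move=> cx wx S; have [x0 xh xc] := cx.
have [Sh|nSh] := boolP (S \in boolean_hat n); last first.
  rewrite /gap (negPf nSh); apply/esym/eqP; apply: contraT => /xh.
  by rewrite (negPf nSh).
have [i [j [iS jS imin jmax ->]]] := gap_attained w Sh; rewrite wx.
(* A set [T] of nonzero weight with [j] and without [i] is incomparable with [S], so [x S] is 0; it
   also puts [j] above [i], so the gap is 0. *)
have [[T xT /andP[jT iT]]|noT] :=
    pselect (exists2 T, x T != 0 & (j \in T) && (i \notin T)).
  have xS : x S = 0.
    apply/eqP; apply: contraT => xS.
    case/orP: (xc _ _ xS xT) => /subsetP h; first by rewrite h in iT.
    by rewrite h in jS.
  rewrite xS max_l // -oppr_ge0 opprB (le_trans (x0 T)) //.
  exact: height_diff_ge.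
rewrite height_diff [X in _ - X]big1 ?subr0; last first.
  by move=> T jiT; apply/eqP; apply: contraT => xT; case: noT; exists T.
(* No other set of nonzero weight separates [i] from [j]: an element of [T] outside [S] would be
   higher than [j], and an element of [S] outside [T] lower than [i]. *)
rewrite (bigD1 S) ?iS //= big1 ?addr0 ?max_r // => T /andP[/andP[iT jT] TS].
apply/eqP; apply: contraT => xT; case/eqP: TS; apply/eqP; rewrite eqEsubset.
have xT0 : 0 < x T by rewrite lt_def xT x0.
apply/andP; split; apply/subsetP=> k kS; apply: contraT => kT.
  have := jmax k kT; rewrite -subr_ge0 wx => h.
  have := @height_diff_ge x k j T cx xT kS jT.
  by rewrite -opprB lerNr => /(le_trans h); rewrite oppr_ge0 leNgt xT0.
have := imin k kS; rewrite -subr_ge0 wx => h.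
have := @height_diff_ge x i k T cx xT iT kT.
by rewrite -opprB lerNr => /(le_trans h); rewrite oppr_ge0 leNgt xT0.
Qed.

(** This is the existence half, by induction on the size of the support: a nonnegative vector is
    peeled into level sets, which form a chain. The zero of [w] keeps these sets proper. *)
Lemma chainlike_height_ge0 w : (forall i, 0 <= w i) -> (forall i0 : 'I_n, exists i, w i = 0) ->
  exists x, [/\ chainlike x, forall S, x S != 0 -> S \subset [set i | w i != 0] &
                forall i, height x i = w i].
Proof.
have [m] := ubnP #|[set i | w i != 0]|; elim: m w => // m IH w wm w0 wz.
set T := [set i | w i != 0] in wm *.
have [T0|[i0 i0T]] := set_0Vmem T.
  exists (fun=> 0); split.
  - by split=> [//|S|S S']; rewrite eqxx.
  - by move=> S; rewrite eqxx.
  - move=> i; rewrite /height big1 //; apply/esym/eqP; apply: contraT => wi.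
    have iT : i \in T by rewrite inE.
    by rewrite T0 inE in iT.
have [i iT imin] := @arg_minP _ _ _ i0 [pred i | i \in T] w i0T.
have {}iT : i \in T := iT; have [z wz0] := wz i0.
have Ti : 0 < w i by rewrite lt_def w0 andbT; move: iT; rewrite /= inE.
(* The least positive value [w i] becomes the weight of the support [T]. Subtracting it removes [i]
   from the support, so the rest of the chain lies strictly inside [T]. *)
pose w' k := w k - (if k \in T then w i else 0).
have w'0 k : 0 <= w' k.
  by rewrite /w'; case: ifP => kT; rewrite ?subr0 // subr_ge0 imin.
have w'T k : w' k != 0 -> k \in T.
  by rewrite /w'; case: ifP => // kT; rewrite subr0; move: kT; rewrite inE => ->.
have T'lt : (#|[set k | (w' k != 0)%R]| < m)%N.
  rewrite -ltnS; apply: leq_trans wm; rewrite ltnS; apply: proper_card; apply/properP; split.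
    by apply/subsetP=> k; rewrite inE => /w'T.
  by exists i => //; rewrite inE /w' iT subrr eqxx.
have [||x [[x0 xh xc] xT xw]] := IH w' T'lt.
- exact: w'0.
- move=> _; exists z; rewrite /w'; case: ifP; last by rewrite wz0 subr0.
  by rewrite inE wz0 eqxx.
have sT S : x S != 0 -> S \subset T.
  by move/xT => h; apply: (subset_trans h); apply/subsetP=> k; rewrite inE => /w'T.
have xTT : x T = 0.
  apply/eqP; apply: contraT => /xT /subsetP/(_ _ iT).
  by rewrite inE /w' iT subrr eqxx.
pose y S := x S + (if S == T then w i else 0).
have yT S : y S != 0 -> S = T \/ x S != 0.
  by rewrite /y; case: (eqVneq S T) => [->|_]; [left|rewrite addr0; right].
exists y; split; first split.
- by move=> S; rewrite addr_ge0 ?x0 //; case: ifP => // _; apply: ltW.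
- move=> S /yT[->|/xh //]; apply/boolean_hatP; split; first by exists i0.
  by exists z; rewrite inE wz0 eqxx.
- move=> S S' /yT[->|xS] /yT[->|xS']; rewrite ?subxx ?sT ?orbT //; exact: xc.
- by move=> S /yT[->|/sT].
move=> k; rewrite /height big_split /= -/(height x k) xw /w' -big_mkcondr /=.
case: ifP => kT.
  by rewrite (big_pred1 T) ?subrK // => S; rewrite andbC /=; case: (eqVneq S T) => //= ->.
by rewrite big_pred0 ?subrK // => S; rewrite andbC /=; case: (eqVneq S T) => //= ->.
Qed.

Lemma chainlike_height w : exists2 x, chainlike x &
  forall i j, w i - w j = height x i - height x j.
Proof.
have [[i0]|no] := pselect (exists i : 'I_n, true); last first.
  exists (fun=> 0); first by split=> [//|S|S S']; rewrite eqxx.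
  by move=> i; case: no; exists i.
have [i _ imin] := @arg_minP _ _ _ i0 xpredT w isT.
have [||x [cx _ xw]] := @chainlike_height_ge0 (fun k => w k - w i).
- by move=> k; rewrite subr_ge0 imin.
- by move=> _; exists i; rewrite subrr.
by exists x => // k l; rewrite !xw opprB addrA subrK.
Qed.

(** Every vector has the height differences of some chainlike function, and [gap] returns that
    function. *)
Lemma gap_chainlike w : chainlike (gap w).
Proof.
have [x cx /(gap_eq cx) xw] := chainlike_height w.
by have -> : gap w = x by apply: funext.
Qed.

Lemma height_gap w i j : height (gap w) i - height (gap w) j = w i - w j.
Proof.
have [x cx xw] := chainlike_height w.
by rewrite xw; have -> : gap w = x by apply/funext/gap_eq.
Qed.

(** The function [a * gap w] is chainlike with the height differences of [w'], so [gap_eq]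
    applies. *)
Lemma gap_proportional w w' a : 0 <= a ->
  (forall i j, w' i - w' j = a * (w i - w j)) -> forall S, gap w' S = a * gap w S.
Proof.
move=> a0 h; apply: gap_eq.
  have [x0 xh xc] := gap_chainlike w.
  have aN S : a * gap w S != 0 -> gap w S != 0 by apply: contraNneq => ->; rewrite mulr0.
  split=> [S|S /aN|S T /aN xS /aN]; [exact: mulr_ge0|exact: xh|exact: xc].
by move=> i j; rewrite h -height_gap /height -!mulr_sumr mulrBr.
Qed.

Lemma gap_neq0 w S i j : gap w S != 0 -> i \in S -> j \notin S -> w j < w i.
Proof.
move=> gS iS jS; rewrite -subr_gt0 -height_gap.
apply: lt_le_trans (height_diff_ge (gap_chainlike w) gS iS jS).
by rewrite lt_def gS gap_ge0.
Qed.

Definition total w : R := \sum_(S : {set 'I_n}) gap w S.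

Lemma total_gt0 w i j : w i != w j -> 0 < total w.
Proof.
move=> wij; rewrite lt_def sumr_ge0 ?andbT; last by move=> S _; apply: gap_ge0.
apply: contraNneq wij => /eqP; rewrite psumr_eq0 => [/allP g0|S _]; last exact: gap_ge0.
rewrite -subr_eq0 -height_gap /height !big1 ?subrr // => S _; apply/eqP/g0;
  exact: mem_index_enum.
Qed.

End Gaps.

(** * Continuity, and realizations of isomorphic complexes *)

Section Topology.
Local Open Scope ring_scope.
Local Open Scope set_scope.
Variable R : realType.

(** Continuity is asked in the ambient spaces at the points of [A] and [B]; in this form it composes
    directly, and it implies the continuity within the subspaces. *)
Definition homeomorphic_in (X Y : topologicalType) (A : set X) (B : set Y) : Prop :=
  exists (f : X -> Y) (g : Y -> X),
    [/\ (forall x, A x -> {for x, continuous f}) /\ (forall y, B y -> {for y, continuous g}),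
        forall x, A x -> B (f x),
        forall y, B y -> A (g y),
        forall x, A x -> g (f x) = x &
        forall y, B y -> f (g y) = y].

Lemma homeomorphic_in_trans (X Y Z : topologicalType) (A : set X) (B : set Y) (C : set Z) :
  homeomorphic_in A B -> homeomorphic_in B C -> homeomorphic_in A C.
Proof.
move=> [f [g [[fc gc] fAB gBA gK fK]]] [f' [g' [[fc' gc'] fBC gCB gK' fK']]].
exists (f' \o f), (g \o g'); split=> /=; first split.
- by move=> x Ax; apply: continuous_comp; [apply: fc|apply/fc'/fAB].
- by move=> y Cy; apply: continuous_comp; [apply: gc'|apply/gc/gCB].
- by move=> x /fAB/fBC.
- by move=> y /gCB/gBA.
- by move=> x Ax; rewrite gK' ?gK //; apply: fAB.
- by move=> y Cy; rewrite fK ?fK' //; apply: gCB.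
Qed.

Lemma homeomorphic_inW (X Y : topologicalType) (A : set X) (B : set Y) :
  homeomorphic_in A B -> homeomorphic A B.
Proof.
move=> [f [g [[fc gc] fAB gBA gK fK]]]; exists f, g; split=> //; split.
  by apply: continuous_in_subspaceT => x /set_mem/fc.
by apply: continuous_in_subspaceT => x /set_mem/gc.
Qed.

Section ContinuousAt.
Variables (T : topologicalType) (t : T).

Lemma continuous_row_at k (F : T -> 'I_k -> R) :
    (forall j, {for t, continuous (fun u => F u j)}) ->
  {for t, continuous (fun u => \row_j F u j : 'rV[R]_k)}.
Proof.
move=> Fc A [P Pn PA].
have h : \forall u \near t, forall j, P 0 j (F u j).
  by apply: filter_forall => j; apply: Fc; have := Pn 0 j; rewrite mxE.
apply: filterS h => u h; apply: PA => i j; rewrite mxE ord1; exact: h.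
Qed.

Lemma continuous_sum_at (I : Type) (r : seq I) (P : pred I) (F : T -> I -> R) :
    (forall i, P i -> {for t, continuous (fun u => F u i)}) ->
  {for t, continuous (fun u => \sum_(i <- r | P i) F u i)}.
Proof.
move=> Fc; elim: r => [|i r IH].
  rewrite (_ : (fun _ => _) = fun=> 0); first exact: cst_continuous.
  by apply: funext => u; rewrite big_nil.
have [Pi|nPi] := boolP (P i); last first.
  rewrite (_ : (fun _ => _) = fun u => \sum_(i <- r | P i) F u i) //.
  by apply: funext => u; rewrite big_cons (negPf nPi).
rewrite (_ : (fun _ => _) = fun u => F u i + \sum_(i <- r | P i) F u i).
  exact: (continuousD (Fc i Pi) IH).
by apply: funext => u; rewrite big_cons Pi.
Qed.

Lemma continuous_bigmin_at (I : Type) (r : seq I) (P : pred I) (F : T -> I -> R) (m : T -> R) :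
    {for t, continuous m} -> (forall i, {for t, continuous (fun u => F u i)}) ->
  {for t, continuous (fun u => \big[Num.min/m u]_(i <- r | P i) F u i)}.
Proof.
move=> mc Fc; elim: r => [|i r IH].
  rewrite (_ : (fun _ => _) = m) //.
  by apply: funext => u; rewrite big_nil.
have [Pi|nPi] := boolP (P i); last first.
  rewrite (_ : (fun _ => _) = fun u => \big[Num.min/m u]_(i <- r | P i) F u i) //.
  by apply: funext => u; rewrite big_cons (negPf nPi).
rewrite (_ : (fun _ => _) = fun u => Num.min (F u i) (\big[Num.min/m u]_(i <- r | P i) F u i)).
  exact: (continuous_min (Fc i) IH).
by apply: funext => u; rewrite big_cons Pi.
Qed.

Lemma continuous_gap_at n (w : T -> 'I_n -> R) S :
    (forall i, {for t, continuous (fun u => w u i)}) ->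
  {for t, continuous (fun u => gap (w u) S)}.
Proof.
move=> wc; have [Sh|nSh] := boolP (S \in boolean_hat n); last first.
  rewrite (_ : (fun _ => _) = fun=> 0); first exact: cst_continuous.
  by apply: funext => u; rewrite /gap (negPf nSh).
rewrite (_ : (fun _ => _) = fun u => Num.max 0 (\big[Num.min/
    \sum_(p : 'I_n * 'I_n) `|w u p.1 - w u p.2|]_(p : 'I_n * 'I_n |
      (p.1 \in S) && (p.2 \notin S)) (w u p.1 - w u p.2))); last first.
  by apply: funext => u; rewrite /gap Sh.
apply: (@continuous_max R T (fun=> 0)); first exact: cst_continuous.
have dc (p : 'I_n * 'I_n) : {for t, continuous (fun u => w u p.1 - w u p.2)}.
  exact: (continuousB (wc p.1) (wc p.2)).
apply: continuous_bigmin_at => //; apply: continuous_sum_at => p _.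
apply: (@continuous_comp _ _ _ (fun u => w u p.1 - w u p.2) (fun y : R => `|y|)) => //.
exact: norm_continuous.
Qed.

Lemma continuous_total_at n (w : T -> 'I_n -> R) :
    (forall i, {for t, continuous (fun u => w u i)}) ->
  {for t, continuous (fun u => total (w u))}.
Proof. by move=> wc; apply: continuous_sum_at => S _; apply: continuous_gap_at. Qed.

End ContinuousAt.

Lemma continuous_entry n (k : 'I_n) : continuous (fun x : 'rV[R]_n => x 0 k).
Proof. exact: coord_continuous. Qed.

Definition coords (V : finType) (x : 'rV[R]_#|V|) (v : V) : R := x 0 (enum_rank v).

Definition point (V : finType) (c : V -> R) : 'rV[R]_#|V| := \row_k c (enum_val k).

Lemma pointK (V : finType) (c : V -> R) v : coords (point c) v = c v.
Proof. by rewrite /coords mxE enum_rankK. Qed.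

Lemma coords_inj (V : finType) (x y : 'rV[R]_#|V|) : coords x =1 coords y -> x = y.
Proof.
move=> xy; apply/rowP=> k; have := xy (enum_val k).
by rewrite /coords enum_valK.
Qed.

Lemma sum_coords (V : finType) (x : 'rV[R]_#|V|) (K : {set {set V}}) :
  realization K x -> \sum_v coords x v = 1.
Proof. by case. Qed.

Definition supp (V : finType) (x : 'rV[R]_#|V|) : {set V} := [set v | coords x v != 0].

Lemma mem_supp (V : finType) (x : 'rV[R]_#|V|) v : (v \in supp x) = (coords x v != 0).
Proof. by rewrite inE. Qed.

Lemma continuous_point_at (T : topologicalType) (t : T) (V : finType) (c : T -> V -> R) :
    (forall v, {for t, continuous (fun u => c u v)}) ->
  {for t, continuous (fun u => point (c u))}.
Proof. by move=> cc; apply: continuous_row_at => j; apply: cc. Qed.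

Lemma continuous_coords (V : finType) (v : V) : continuous (fun x : 'rV[R]_#|V| => coords x v).
Proof. exact: continuous_entry. Qed.

Lemma is_complexP (V : finType) (K : {set {set V}}) (F F' : {set V}) :
  is_complex K -> F \in K -> F' \subset F -> F' \in K.
Proof. by move=> /'forall_implyP h /h /'forall_implyP; apply. Qed.

(** The vertex bijection extends linearly: [phi] pushes coordinates forward along [f] and [psi]
    pulls them back. *)
Lemma realization_iso (V W : finType) (K : {set {set V}}) (L : {set {set W}}) :
  is_complex K -> complex_iso K L -> homeomorphic_in (@realization R V K) (@realization R W L).
Proof.
move=> cK [f [f_inj fK]].
have vert F v : F \in K -> v \in F -> [set v] \in K.
  by move=> FK vF; apply: (is_complexP cK FK); rewrite sub1set.
(* [f] is known to be injective only on the vertices of [K], so both maps disregard the other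
   elements of [V]. *)
pose phi (x : 'rV[R]_#|V|) := point (fun w => \sum_(v | ([set v] \in K) && (f v == w)) coords x v).
pose psi (y : 'rV[R]_#|W|) := point (fun v => if [set v] \in K then coords y (f v) else 0).
have phiE x v : [set v] \in K -> coords (phi x) (f v) = coords x v.
  move=> vK; rewrite pointK (big_pred1 v) // => v' /=.
  apply/andP/eqP => [[v'K /eqP]|->]; last by rewrite vK.
  by apply: f_inj.
have phi0 x w : (forall v, [set v] \in K -> f v != w) -> coords (phi x) w = 0.
  by move=> h; rewrite pointK big_pred0 // => v; apply/negP=> /andP[/h/negP].
have psiK y v : [set v] \in K -> coords (psi y) v = coords y (f v).
  by move=> vK; rewrite pointK vK.
have suppK x v : realization K x -> coords x v != 0 -> [set v] \in K.
  by case=> _ _ sK xv; apply: vert sK _; rewrite inE.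
have supp_phi x : realization K x -> supp (phi x) = f @: supp x.
  move=> Kx; apply/setP=> w; rewrite mem_supp; apply/idP/imsetP => [|[v]]; last first.
    by rewrite mem_supp => xv ->; rewrite phiE //; apply: suppK xv.
  rewrite pointK => h; have [[v vK fv]|no] := pselect (exists2 v, [set v] \in K & f v = w).
    exists v => //; rewrite mem_supp -phiE // fv pointK //.
  case/eqP: h; rewrite big_pred0 // => v; apply/negP=> /andP[vK /eqP fv].
  by case: no; exists v.
have supp_psi y F : F \in K -> supp y = f @: F -> supp (psi y) = F.
  move=> FK sy; apply/setP=> v; rewrite mem_supp; apply/idP/idP => [|vF].
    rewrite pointK; case: ifP => [vK|]; last by rewrite eqxx.
    rewrite -mem_supp sy => /imsetP[v' v'F /f_inj ->] //; exact: (vert F).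
  by rewrite psiK ?(vert F) // -mem_supp sy imset_f.
exists phi, psi; split; first split.
- move=> x _; apply: continuous_point_at => w; apply: continuous_sum_at => v _.
  exact: continuous_coords.
- move=> y _; apply: continuous_point_at => v.
  by case: ([set v] \in K); [apply: continuous_coords|apply: cst_continuous].
- move=> x Kx; have [x0 x1 sK] := Kx; split.
  + by move=> w; rewrite -/(coords (phi x) w) pointK; apply: sumr_ge0 => v _; apply: x0.
  + rewrite -[RHS](sum_coords Kx) -[LHS]/(\sum_w coords (phi x) w).
    under eq_bigr do rewrite pointK.
    rewrite (exchange_big_dep xpredT) //=; apply: eq_bigr => v _.
    have [vK|vK] := boolP ([set v] \in K).
      by rewrite (big_pred1 (f v)) // => w; rewrite /= eq_sym.
    rewrite big_pred0 //; apply/esym/eqP; apply: contraNT vK; exact: suppK.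
  + by rewrite -[[set _ | _]]/(supp (phi x)) supp_phi // -fK imset_f.
- move=> y Ly; have [y0 y1] := Ly; rewrite -[[set _ | _]]/(supp y) -fK => /imsetP[F FK sy].
  split.
  + by move=> v; rewrite -/(coords (psi y) v) pointK; case: ifP => // _; apply: y0.
  + rewrite -[RHS](sum_coords Ly) -[LHS]/(\sum_v coords (psi y) v).
    rewrite (bigID (mem (supp (psi y)))) /= [X in _ + X]big1 ?addr0; last first.
      by move=> v; rewrite mem_supp negbK => /eqP.
    rewrite [RHS](bigID (mem (supp y))) /= [X in _ = _ + X]big1 ?addr0; last first.
      by move=> w; rewrite mem_supp negbK => /eqP.
    rewrite (supp_psi _ _ FK sy) sy big_imset /=; last first.
      by move=> u v uF vF; apply: f_inj; apply: (vert F).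
    by apply: eq_bigr => v vF; rewrite psiK ?(vert F).
  + by rewrite -[[set _ | _]]/(supp (psi y)) (supp_psi _ _ FK sy).
- move=> x Kx; apply: coords_inj => v; have [vK|vK] := boolP ([set v] \in K).
    by rewrite psiK // phiE.
  rewrite pointK (negPf vK); apply/esym/eqP; apply: contraNT vK; exact: suppK.
- move=> y Ly; apply: coords_inj => w; have [_ _] := Ly.
  rewrite -[[set _ | _]]/(supp y) -fK => /imsetP[F FK sy].
  have [[v vK <-]|no] := pselect (exists2 v, [set v] \in K & f v = w).
    by rewrite phiE // psiK.
  rewrite phi0 => [|v vK]; last by apply/eqP=> fv; case: no; exists v.
  apply/esym/eqP; apply: contraT; rewrite -mem_supp sy => /imsetP[v vF wE].
  by case: no; exists v => //; apply: (vert F).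
Qed.

End Topology.

(** * The truncated Boolean algebra realizes a sphere *)

Section Sphere.
Local Open Scope ring_scope.
Local Open Scope set_scope.
Variable R : realType.

(** Central projection: for a nonconstant [w], the point of the realization whose heights are [w] up
    to translation and positive scaling. *)
Definition proj n (w : 'I_n -> R) : 'rV[R]_#|{set 'I_n}| :=
  point (fun S => gap w S / total w).

Lemma coords_proj n (w : 'I_n -> R) S : coords (proj w) S = gap w S / total w.
Proof. exact: pointK. Qed.

Lemma realization_order_complex n (P : {set {set 'I_n}}) (x : 'rV[R]_#|{set 'I_n}|) :
  P \subset boolean_hat n ->
  realization (order_complex P) x <->
    [/\ chainlike (coords x), \sum_S coords x S = 1 & forall S, coords x S != 0 -> S \in P].
Proof.
move=> /subsetP Ph; split=> [Kx|[[x0 xh xc] x1 xP]].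
  have [x0 x1] := Kx; rewrite -[[set _ | _]]/(supp x) inE => /andP[/subsetP sP chS].
  have xP S : coords x S != 0 -> S \in P by rewrite -mem_supp; apply: sP.
  split=> //; last by split=> // [S /xP/Ph //|S T xS xT]; apply: (chain_total chS); rewrite mem_supp.
split=> //; rewrite -[[set _ | _]]/(supp x) inE; apply/andP; split.
  by apply/subsetP=> S; rewrite mem_supp; apply: xP.
apply/'forall_implyP=> S; rewrite mem_supp => xS.
by apply/'forall_implyP=> T; rewrite mem_supp => xT; apply: xc.
Qed.

Lemma proj_realization n (w : 'I_n -> R) (P : {set {set 'I_n}}) i j :
    P \subset boolean_hat n -> w i != w j -> (forall S, gap w S != 0 -> S \in P) ->
  realization (order_complex P) (proj w).
Proof.
move=> Ph wij wP; apply/realization_order_complex => //.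
have t0 := total_gt0 wij; have [g0 gh gc] := gap_chainlike w.
have gN S : coords (proj w) S != 0 -> gap w S != 0.
  by rewrite pointK; apply: contraNneq => ->; rewrite mul0r.
split=> [||S /gN/wP //].
  split=> [S|S /gN/gh //|S T /gN gS /gN gT]; last exact: gc.
  by rewrite pointK divr_ge0 // ltW.
under eq_bigr do rewrite pointK.
by rewrite -mulr_suml divff // gt_eqF.
Qed.

(** The scaling factor [a] equals [total w], so the normalization in [proj] cancels it. *)
Lemma proj_height n (w : 'I_n -> R) (x : 'rV[R]_#|{set 'I_n}|) a :
    0 < a -> chainlike (coords x) -> \sum_S coords x S = 1 ->
    (forall i j, w i - w j = a * (height (coords x) i - height (coords x) j)) ->
  proj w = x.
Proof.
move=> a0 cx x1 wx; have gE S : gap w S = a * coords x S.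
  rewrite (gap_proportional (ltW a0) wx); congr (_ * _).
  by apply: gap_eq.
have tE : total w = a.
  by rewrite /total (eq_bigr (fun S => a * coords x S)) // -mulr_sumr x1 mulr1.
by apply: coords_inj => S; rewrite pointK gE tE mulrC mulKf // gt_eqF.
Qed.

Lemma height_proj n (w : 'I_n -> R) i j :
  height (coords (proj w)) i - height (coords (proj w)) j = (w i - w j) / total w.
Proof.
rewrite -(height_gap w) /height mulrBl !mulr_suml.
by congr (_ - _); apply: eq_bigr => S _; rewrite coords_proj.
Qed.

Lemma continuous_proj_at (T : topologicalType) (t : T) n (w : T -> 'I_n -> R) :
    (forall i, {for t, continuous (fun u => w u i)}) -> total (w t) != 0 ->
  {for t, continuous (fun u => proj (w u))}.
Proof.
move=> wc tw; apply: continuous_point_at => S.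
apply: (@continuousM _ _ (fun u => gap (w u) S) (fun u => (total (w u))^-1)).
  exact: continuous_gap_at.
apply: (@continuousV _ _ (fun u => total (w u))) => //; exact: continuous_total_at.
Qed.

Lemma continuous_height n (i : 'I_n) :
  continuous (fun x : 'rV[R]_#|{set 'I_n}| => height (coords x) i).
Proof. by move=> x; apply: continuous_sum_at => S _; apply: continuous_coords. Qed.

(* The point with barycentric coordinates [c] goes to the direction of its
   heights, measured from the height of the last element. *)
Lemma sphere_boolean_hat m :
  homeomorphic_in (realization (R := R) (order_complex (boolean_hat m.+1))) (@unit_sphere R m).
Proof.
pose z (x : 'rV[R]_#|{set 'I_m.+1}|) (k : 'I_m) :=
  height (coords x) (lift ord_max k) - height (coords x) ord_max.
pose s x := \sum_(k < m) z x k ^+ 2.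
pose f x : 'rV[R]_m := \row_k (z x k / Num.sqrt (s x)).
(* Heights matter only up to translation, so a vector with [m] entries is a height vector on [m.+1]
   elements whose last height is 0. *)
pose ext (y : 'rV[R]_m) (i : 'I_m.+1) := if unlift ord_max i is Some k then y 0 k else 0.
have ext_lift y k : ext y (lift ord_max k) = y 0 k by rewrite /ext liftK.
have ext_max y : ext y ord_max = 0 by rewrite /ext unlift_none.
pose K := realization (R := R) (order_complex (boolean_hat m.+1)).
have KP x : K x -> [/\ chainlike (coords x), \sum_S coords x S = 1 &
    forall S, coords x S != 0 -> S \in boolean_hat m.+1].
  by move/realization_order_complex; apply.
(* If all heights agreed, [height_diff_ge] would force every coordinate to be 0, against their sum
   1. *)
have s_gt0 x : K x -> 0 < s x.
  case/KP=> cx x1 xh; rewrite lt_def sumr_ge0 ?andbT; last by move=> k _; apply: sqr_ge0.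
  apply/negP; rewrite psumr_eq0 => [/allP z0|k _]; last exact: sqr_ge0.
  have hE i : height (coords x) i = height (coords x) ord_max.
    case: (unliftP ord_max i) => [k ->|-> //]; apply/eqP.
    have := z0 k (mem_index_enum _); rewrite expf_eq0 /= subr_eq0; exact.
  have x0 S : coords x S = 0.
    apply/eqP; apply: contraT => xS; have [[i iS] [j jS]] := boolean_hatP _ (xh S xS).
    have := height_diff_ge cx xS iS jS; rewrite (hE i) (hE j) subrr.
    have [x0 _ _] := cx; have := x0 S.
    by rewrite le_eqVlt eq_sym (negPf xS) /= => /lt_le_trans/[apply]; rewrite ltxx.
  by move/eqP: x1; rewrite big1 // eq_sym oner_eq0.
have y_neq0 y : unit_sphere y -> exists k, ext y (lift ord_max k) != ext y ord_max.
  move=> y1; apply: contrapT => no; move/eqP: y1; rewrite big1 ?(eq_sym 0) ?oner_eq0 //.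
  move=> k _; apply/eqP; rewrite expf_eq0 /=; apply: contraT => yk.
  by case: no; exists k; rewrite ext_lift ext_max.
have extP y : unit_sphere y -> K (proj (ext y)).
  move=> /y_neq0[k yk]; apply: (proj_realization _ yk) => // S.
  by have [_ h _] := gap_chainlike (ext y); apply: h.
have extB x i j : ext (f x) i - ext (f x) j =
    (Num.sqrt (s x))^-1 * (height (coords x) i - height (coords x) j).
  have h k : ext (f x) k = (height (coords x) k - height (coords x) ord_max) / Num.sqrt (s x).
    case: (unliftP ord_max k) => [l ->|->]; first by rewrite ext_lift mxE.
    by rewrite ext_max subrr mul0r.
  by rewrite !h -mulrBl opprB addrA subrK mulrC.
exists f, (fun y => proj (ext y)); split; first split.
- move=> x Kx; have zc k : {for x, continuous (fun u => z u k)}.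
    apply: (@continuousB _ _ _ (fun u => height (coords u) (lift ord_max k))
      (fun u => height (coords u) ord_max)); exact: continuous_height.
  apply: continuous_row_at => k.
  apply: (@continuousM _ _ (fun u => z u k) (fun u => (Num.sqrt (s u))^-1)); first exact: zc.
  apply: (@continuousV _ _ (fun u => Num.sqrt (s u))).
    by rewrite gt_eqF // sqrtr_gt0 s_gt0.
  apply: (@continuous_comp _ _ _ s Num.sqrt); last exact: sqrt_continuous.
  apply: continuous_sum_at => l _.
  exact: (continuousM (zc l) (zc l)).
- move=> y y1; have [k yk] := y_neq0 y y1.
  apply: continuous_proj_at; last by rewrite gt_eqF // (total_gt0 yk).
  move=> i; rewrite /ext; case: (unlift ord_max i) => [l|]; last exact: cst_continuous.
  exact: continuous_entry.
- move=> x Kx; rewrite /unit_sphere /=; rewrite (eq_bigr (fun k => z x k ^+ 2 * (s x)^-1)).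
    by rewrite -mulr_suml -/(s x) divff // gt_eqF ?s_gt0.
  by move=> k _; rewrite mxE exprMn exprVn sqr_sqrtr // ltW // s_gt0.
- exact: extP.
- move=> x Kx; have [cx x1 _] := KP x Kx.
  apply: (@proj_height _ _ _ (Num.sqrt (s x))^-1) => //.
  by rewrite invr_gt0 sqrtr_gt0 s_gt0.
- move=> y y1; have [k0 yk] := y_neq0 y y1.
  have t0 := total_gt0 yk; have zE k : z (proj (ext y)) k = y 0 k / total (ext y).
    by rewrite /z height_proj ext_lift ext_max subr0.
  (* [proj] divides the heights by [total], and [y] has norm 1, so rescaling to norm 1 undoes
     exactly this division. *)
  have sE : s (proj (ext y)) = (total (ext y))^-1 ^+ 2.
    rewrite /s (eq_bigr (fun k => y 0 k ^+ 2 * (total (ext y))^-1 ^+ 2)).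
      by rewrite -mulr_suml y1 mul1r.
    by move=> k _; rewrite zE exprMn.
  apply/rowP=> k; rewrite mxE zE sE sqrtr_sqr ger0_norm ?invr_ge0 ?ltW //.
  by rewrite invrK divfK // gt_eqF.
Qed.

Lemma sphere_in_dim_iso (V : finType) (K : {set {set V}}) m :
  is_complex K -> complex_iso K (order_complex (boolean_hat m.+1)) -> sphere_in_dim R m K.
Proof.
move=> cK isoK; apply: homeomorphic_inW.
exact: homeomorphic_in_trans (realization_iso R cK isoK) (sphere_boolean_hat m).
Qed.

End Sphere.

(** * Separation of an edge-sphere by another one *)

Section Halves.
Local Open Scope ring_scope.
Local Open Scope set_scope.
Variables (R : realType) (d : nat).
Implicit Types (i j : 'I_d) (S T : {set 'I_d}) (F : {set {set 'I_d}}).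

(** An involution of the ground set that exchanges the faces of [K] and [L] carries maximal faces
    injectively to maximal faces. *)
Lemma leq_card_facets (V : finType) (K L : {set {set V}}) (c : V -> V) :
    involutive c -> (forall F : {set V}, F \in K -> c @: F \in L) ->
    (forall F : {set V}, F \in L -> c @: F \in K) ->
  (#|facets K| <= #|facets L|)%N.
Proof.
move=> cc KL LK; have ccF : involutive (fun F : {set V} => c @: F).
  by move=> F; rewrite -imset_comp (eq_imset (g := id)) ?imset_id.
rewrite -(card_imset _ (inv_inj ccF)); apply/subset_leq_card/subsetP=> F' /imsetP[F].
rewrite inE => /maxsetP[FK max] ->; rewrite inE; apply/maxsetP; split; first exact: KL.
move=> G /LK GK FG; have /= cF := ccF F; have /= cG := ccF G.
by rewrite -(max _ GK) ?cG // -cF imsetS.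
Qed.

Lemma respects_setC (e S : {set 'I_d}) : respects e (~: S) = respects e S.
Proof. by rewrite /respects disjoints_subset setCK orbC -disjoints_subset. Qed.

Lemma boolean_hat_setC S : S \in boolean_hat d -> ~: S \in boolean_hat d.
Proof.
move/boolean_hatP=> [[x xS] [y yS]]; apply/boolean_hatP.
by split; [exists y|exists x]; rewrite inE ?negbK.
Qed.

(** In terms of heights, this is the part of the [e]-sphere where [j] is at most as high as [i]. *)
Definition half (e : {set 'I_d}) i j : {set {set {set 'I_d}}} :=
  order_complex [set S in edge_vertices e | (j \in S) ==> (i \in S)].

Variables a b : 'I_d.
Let e := [set a; b].

Lemma edge_vertices_sub : edge_vertices e \subset boolean_hat d.
Proof. by apply/subsetP=> S; rewrite inE => /andP[]. Qed.

Let P := edge_vertices e.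

(** Complementation reverses inclusions and still splits no new edge, while it exchanges the roles
    of [i] and [j]. It thus matches the facets of the two halves. *)
Lemma half_setC i j F : F \in half e i j -> (@setC _) @: F \in half e j i.
Proof.
rewrite !inE => /andP[/subsetP sF chF]; apply/andP; split.
  apply/subsetP=> _ /imsetP[S /sF SP ->]; move: SP.
  rewrite [S \in _]inE mem_edge_vertices => /andP[/andP[Sh Se] Sij].
  rewrite [~: S \in _]inE mem_edge_vertices respects_setC Se boolean_hat_setC // !inE.
  by case: (i \in S) Sij; case: (j \in S).
apply/'forall_implyP=> _ /imsetP[A AF ->]; apply/'forall_implyP=> _ /imsetP[B BF ->].
by rewrite !setCS orbC (chain_total chF).
Qed.

Lemma card_facets_half i j : #|facets (half e i j)| = #|facets (half e j i)|.
Proof.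
by apply/eqP; rewrite eqn_leq; apply/andP; split; apply: (leq_card_facets (@setCK _));
  move=> F; apply: half_setC.
Qed.

(** A set with [i] and not [j] is incomparable with a set with [j] and not [i], so a chain separates
    the two elements in at most one direction. *)
Lemma half_setU i j : order_complex P = half e i j :|: half e j i.
Proof.
apply/setP=> F; rewrite !inE; apply/andP/orP => [[/subsetP sF chF]|].
  have [/existsP[T /and3P[TF iT jT]]|/existsPn h] :=
      boolP [exists T, [&& T \in F, i \in T & j \notin T]]; [left|right];
    rewrite chF andbT; apply/subsetP=> S SF; rewrite inE sF //=; apply/implyP=> kS.
    case/orP: (chain_total chF SF TF) => /subsetP h; last exact: h.
    by rewrite h in jT.
  by have := h S; rewrite SF kS /= negbK.
by case=> /andP[/subsetP sF ->]; split=> //; apply/subsetP=> S /sF; rewrite inE => /andP[].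
Qed.

Lemma half_setI i j :
  order_complex (P :&: edge_vertices [set i; j]) = half e i j :&: half e j i.
Proof.
rewrite /half order_complexI; congr order_complex; apply/setP=> S.
rewrite !in_setI [S \in edge_vertices [set i; j]]mem_edge_vertices respects_pair.
rewrite [S \in [set _ in _ | (j \in _) ==> _]]inE [S \in [set _ in _ | (i \in _) ==> _]]inE -/P.
case SP: (S \in P) => //=; rewrite (subsetP edge_vertices_sub _ SP).
by case: (i \in S); case: (j \in S).
Qed.

Definition open_half i j : set 'rV[R]_#|{set 'I_d}| :=
  (realization (half e i j) `\`
   realization (order_complex (P :&: edge_vertices [set i; j])))%classic.

Lemma half_sub i j : [set S in P | (j \in S) ==> (i \in S)] \subset boolean_hat d.
Proof.
by apply/subsetP=> S; rewrite inE => /andP[/(subsetP edge_vertices_sub)].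
Qed.

(** A point of the half outside the intersection has a set in its support that splits [i] and [j];
    this set contains [i] and not [j], which makes the inequality strict. *)
Lemma open_halfP i j x : open_half i j x <->
  realization (order_complex P) x /\ height (coords x) j < height (coords x) i.
Proof.
have sP := edge_vertices_sub.
have sPI : P :&: edge_vertices [set i; j] \subset boolean_hat d.
  exact: subset_trans (subsetIl _ _) sP.
rewrite /open_half /setD /=.
split=> [[/(realization_order_complex _ (half_sub i j)) [cx x1 xP] nA]|[]].
  split.
    by apply/(realization_order_complex _ sP); split=> // S /xP; rewrite inE => /andP[].
  have [S [xS Sij]] : exists S, coords x S != 0 /\ ~~ ((i \in S) == (j \in S)).
    apply: contrapT => no; apply: nA; apply/(realization_order_complex _ sPI); split=> // S xS.
    have := xP S xS; rewrite inE => /andP[SP _]; rewrite in_setI SP mem_edge_vertices.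
    rewrite (subsetP sP _ SP) respects_pair /=; apply: contraT => h; case: no; exists S; split=> //.
  have := xP S xS; rewrite inE => /andP[_ Sji].
  have [iS jS] : i \in S /\ j \notin S.
    by move: Sij Sji; case: (i \in S); case: (j \in S).
  have [x0 _ _] := cx; rewrite -subr_gt0; apply: lt_le_trans (height_diff_ge cx xS iS jS).
  by rewrite lt_def xS x0.
move=> /(realization_order_complex _ sP) [cx x1 xP] hij; split.
  apply/(realization_order_complex _ (half_sub i j)); split=> // S xS.
  rewrite inE xP //=; apply/implyP=> jS; apply: contraT => iS.
  have [x0 _ _] := cx; have := height_diff_ge cx xS jS iS.
  move/(le_trans (x0 S)); rewrite subr_ge0 => /(lt_le_trans hij); by rewrite ltxx.
move/(realization_order_complex _ sPI) => [_ _ xI].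
suff hE : height (coords x) i = height (coords x) j by rewrite hE ltxx in hij.
apply: height_eq => S /xI; rewrite in_setI [S \in edge_vertices [set i; j]]mem_edge_vertices.
by rewrite respects_pair => /and3P[_ _ /eqP].
Qed.

Lemma continuous_height_diff i j :
  continuous (fun x : 'rV[R]_#|{set 'I_d}| => height (coords x) i - height (coords x) j).
Proof.
move=> x; apply: (@continuousB _ _ _ (fun u : 'rV[R]_#|{set 'I_d}| => height (coords u) i)
  (fun u => height (coords u) j)); exact: continuous_height.
Qed.

Lemma closure_open_half i j x :
  closure (open_half i j) x -> height (coords x) j <= height (coords x) i.
Proof.
have cl : closed [set x : 'rV[R]_#|{set 'I_d}| |
    0 <= height (coords x) i - height (coords x) j]%classic.
  apply: (@preimage_closed _ _ (fun x : 'rV[R]_#|{set 'I_d}| =>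
    height (coords x) i - height (coords x) j) [set y | 0 <= y]%classic).
    by move=> y _; apply: continuous_height_diff.
  exact: closed_ge.
move=> clx; rewrite -subr_ge0; apply: cl; apply: closure_subset clx => y.
by move/open_halfP => [_ h] /=; rewrite subr_ge0 ltW.
Qed.

(** On the closure of one open half the height inequality survives weakly, which contradicts the
    strict opposite inequality on the other. *)
Lemma separated_open_half i j : separated (open_half i j) (open_half j i).
Proof.
split; apply/seteqP; split=> // x [].
  by move/closure_open_half => h /open_halfP[_]; rewrite ltNge h.
by move=> /open_halfP[_ h] /closure_open_half; rewrite leNgt h.
Qed.

Lemma realization_open_half i j :
  (realization (R := R) (order_complex P) `\`
    realization (order_complex (P :&: edge_vertices [set i; j])) =
   open_half i j `|` open_half j i)%classic.
Proof.
apply/seteqP; split=> x.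
  move=> [Kx nA]; have [x0 x1 sx] := Kx; move: sx; rewrite (half_setU i j) inE => /orP[sx|sx].
    by left; split.
  right; split=> //; by rewrite setUC.
case=> [] /[dup] /open_halfP[Kx _] [_ nA]; split=> //.
by rewrite setUC.
Qed.

(** By [gap_neq0] a set of nonzero gap cannot split two elements of equal height, so every set in
    the support of [proj w] leaves [e] unsplit. *)
Lemma open_half_proj i j (w : 'I_d -> R) : w a = w b -> w j < w i -> open_half i j (proj w).
Proof.
move=> wab wij; have wN : w i != w j by rewrite gt_eqF.
apply/open_halfP; split.
  apply: (proj_realization edge_vertices_sub wN) => S gS.
  have [_ gh _] := gap_chainlike w; rewrite mem_edge_vertices gh // respects_pair.
  have h k l : w k = w l -> k \in S -> l \in S.
    by move=> wkl kS; apply: contraT => lS; have := gap_neq0 gS kS lS; rewrite wkl ltxx.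
  by apply/eqP; apply/idP/idP; apply: h.
by rewrite -subr_gt0 height_proj divr_gt0 ?subr_gt0 // (total_gt0 wN).
Qed.

Section Connected.
Variables (i j : 'I_d) (S0 : {set 'I_d}).
Hypotheses (S0P : S0 \in P) (iS0 : i \in S0) (jS0 : j \notin S0).

(** The height vector of the vertex [S0], the base point of the open half. *)
Let w0 (k : 'I_d) : R := (k \in S0)%:R.

Let w0ab : w0 a = w0 b.
Proof.
by move: S0P; rewrite mem_edge_vertices respects_pair => /andP[_ /eqP h]; rewrite /w0 h.
Qed.

Lemma open_half_nonempty : (open_half i j !=set0)%classic.
Proof.
exists (proj w0); apply: open_half_proj => //.
by rewrite /w0 iS0 (negPf jS0) ltr01.
Qed.

(* In the coordinates given by the heights the open half is convex. *)
Lemma connected_open_half : connected (open_half i j).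
Proof.
(* The straight segment from [w0] to the heights of [x]; the equality on [e] and the strict
   inequality between [i] and [j] persist along it. *)
pose path (x : 'rV[R]_#|{set 'I_d}|) (t : R) (k : 'I_d) := (1 - t) * w0 k + t * height (coords x) k.
have Kh x : open_half i j x -> height (coords x) a = height (coords x) b.
  move=> /open_halfP[/(realization_order_complex _ edge_vertices_sub) [_ _ xP] _].
  by apply: height_eq => S /xP; rewrite mem_edge_vertices respects_pair => /andP[_ /eqP].
have path_lt x t : open_half i j x -> 0 <= t <= 1 -> path x t j < path x t i.
  move=> /open_halfP[_ h] /andP[t0 t1].
  rewrite /path /w0 iS0 (negPf jS0) mulr0 add0r mulr1.
  move: t0; rewrite le_eqVlt => /orP[/eqP<-|t0].
    by rewrite !mul0r subr0 addr0 ltr01.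
  apply: (@lt_le_trans _ _ (t * height (coords x) i)); first by rewrite ltr_pM2l.
  by rewrite lerDr subr_ge0.
have path_in x t : open_half i j x -> 0 <= t <= 1 -> open_half i j (proj (path x t)).
  move=> xh t01; apply: open_half_proj; last exact: path_lt.
  by rewrite /path w0ab (Kh x xh).
(* The open half is a union of images of segments, all of which share the point [proj w0]. *)
have -> : open_half i j =
    (\bigcup_(x in open_half i j) [set proj (path x t) | t in `[0, 1]])%classic.
  apply/seteqP; split=> [x xh|_ [x xh [t /= t01 <-]]].
    exists x => //; exists 1; first by rewrite /= in_itv /= ler01 lexx.
    have /open_halfP[/(realization_order_complex _ edge_vertices_sub) [cx x1 _] _] := xh.
    apply: (@proj_height _ _ _ _ 1) => // k l.
    by rewrite /path subrr !mul0r !add0r !mul1r.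
  by apply: path_in => //; move: t01; rewrite in_itv.
apply: bigcup_connected.
  exists (proj w0) => x xh; exists 0; first by rewrite /= in_itv /= ler01 lexx.
  by congr proj; apply: funext => k; rewrite /path subr0 mul1r mul0r addr0.
move=> x xh; apply: connected_continuous_connected; first exact: segment_connected.
apply: continuous_in_subspaceT => t /set_mem /=; rewrite in_itv /= => t01.
apply: continuous_proj_at; last first.
  by rewrite gt_eqF // (@total_gt0 _ _ _ i j) // gt_eqF // path_lt.
move=> k; apply: (@continuousD _ _ _ (fun t : R => (1 - t) * w0 k : R^o)
  (fun t : R => t * height (coords x) k : R^o)).
  apply: (@continuousM _ _ (fun t : R => 1 - t) (fun=> w0 k)); last exact: cst_continuous.
  apply: (@continuousB _ _ _ (fun=> 1 : R^o) (fun t : R => t : R^o)) => //; exact: cst_continuous.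
apply: (@continuousM _ _ (fun t : R => t) (fun=> height (coords x) k)) => //.
exact: cst_continuous.
Qed.

End Connected.

(** The letter of [i] works: it is [e] or a singleton, and it cannot contain [j] because the two
    edges differ. *)
Lemma open_half_witness i j : i != j -> [set i; j] != e ->
  exists2 S, S \in P & (i \in S) && (j \notin S).
Proof.
move=> ij fe; have ije : (i \in e) -> (j \notin e).
  move=> ie; apply: contra fe => je; rewrite eqEcard subUset !sub1set ie je /=.
  by rewrite !cards2 ij; case: (a != b).
have iS : i \in letter_at e i by apply: mem_letter_at.
have jS : j \notin letter_at e i.
  by rewrite /letter_at; case: ifP => [/ije//|_]; rewrite inE eq_sym.
exists (letter_at e i); rewrite ?iS ?jS // mem_edge_vertices; apply/andP; split.
  by apply/boolean_hatP; split; [exists i|exists j].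
rewrite /letter_at /respects; case: ifP => [_|ie]; first by rewrite subxx.
by rewrite disjoint_sym disjoints_subset sub1set inE ie orbT.
Qed.

Lemma separates_half i j : i != j -> [set i; j] != e ->
  separates_into_halves R (order_complex P) (order_complex (P :&: edge_vertices [set i; j]))
    (half e i j) (half e j i).
Proof.
move=> ij fe.
have [S SP /andP[iS jS]] := open_half_witness ij fe.
have [||T TP /andP[jT iT]] := @open_half_witness j i; [by rewrite eq_sym|by rewrite [[set j; i]]setUC|].
have U2 : (realization (half e j i) `\`
   realization (order_complex (P :&: edge_vertices [set i; j])) = open_half j i)%classic.
  by rewrite /open_half [[set j; i]]setUC.
rewrite /separates_into_halves U2 -/(open_half i j); split.
- split; [exact: is_complex_order_complex|exact: is_complex_order_complex| |].
    exact: half_setU.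
  exact: half_setI.
- exact: card_facets_half.
- exact: realization_open_half.
- exact: separated_open_half.
- split.
  + exact: (open_half_nonempty SP iS jS).
  + exact: (open_half_nonempty TP jT iT).
  + exact: (connected_open_half SP iS jS).
  + exact: (connected_open_half TP jT iT).
Qed.

Lemma vertex_half i j S : [set S] \in order_complex P -> i \in S -> j \notin S ->
  [set S] \in half e i j :\: half e j i.
Proof.
rewrite set1_order_complex => SP iS jS.
by apply/setDP; split; rewrite set1_order_complex inE [S \in _]SP /= iS (negPf jS).
Qed.

End Halves.

Theorem theorem3p4 (R : realType) (d : nat) (G : rel 'I_d)
    (symG : symmetric G) (irrG : irreflexive G) (hd : (3 <= d)%N) :
  ([/\ forall e : {set 'I_d}, e \in edges G ->
         [/\ #|edge_perms e| = (d.-1)`!,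
             {in edge_perms e &, injective (@facet_of d)} &
             #|edge_facets e| = (d.-1)`!],
       (\bigcup_(e in edges G) edge_facets e)%SET = facets (coloring_complex G),
       forall e f : {set 'I_d}, e \in edges G -> f \in edges G -> e != f ->
         [disjoint edge_facets e & edge_facets f],
       forall e : {set 'I_d}, e \in edges G ->
         [/\ sphere_in_dim R (d - 2) (edge_sphere e),
             complex_iso (edge_sphere e) (order_complex (boolean_hat (d - 1))) &
             complex_iso (edge_sphere e)
               (barycentric_subdivision (simplex_boundary (d - 1)))] &
       (edges G != set0 -> complex_dim (coloring_complex G) = (d%:Z - 3%:Z)%R) /\
       (edges G = set0 -> coloring_complex G = set0)])
  /\
  (forall e f : {set 'I_d}, e \in edges G -> f \in edges G -> e != f ->
     [/\ sphere_in_dim R (d - 3) (edge_sphere e :&: edge_sphere f),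
         complex_iso (edge_sphere e :&: edge_sphere f)
           (order_complex (boolean_hat (d - 2))) &
         forall i j : 'I_d, f = [set i; j] ->
           exists H1 H2 : {set {set {set 'I_d}}},
             [/\ separates_into_halves R (edge_sphere e)
                   (edge_sphere e :&: edge_sphere f) H1 H2,
                 forall S : {set 'I_d}, [set S] \in edge_sphere e ->
                   i \in S -> j \notin S -> [set S] \in H1 :\: H2 &
                 forall S : {set 'I_d}, [set S] \in edge_sphere e ->
                   j \in S -> i \notin S -> [set S] \in H2 :\: H1]]).
Proof.
have d_gt0 : (0 < d)%N by apply: leq_trans hd.
have pairP e : e \in edges G -> exists i j, e = [set i; j] /\ i != j.
  case/edgesP=> -[i j] /= Gij ->; exists i, j; split=> //.
  by apply: contraTneq Gij => ->; rewrite irrG.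
have edge2 e : e \in edges G -> #|e| = 2 by apply: card_edge.
(* [sphere_in_dim_iso] matches the index [m] of the sphere with [boolean_hat m.+1], so [d - 1] and
   [d - 2] are needed as successors. *)
have d1 : (d - 1 = (d - 2).+1)%N by rewrite -subSn // ltnW.
have d2 : (d - 2 = (d - 3).+1)%N by rewrite -subSn.
have isoE e : e \in edges G ->
    complex_iso (edge_sphere e) (order_complex (boolean_hat (d - 1))).
  move=> eG; rewrite edge_sphereE ?edge2 //; have [i [j [-> ij]]] := pairP e eG.
  by rewrite subn1; apply: edge_vertices_iso.
have isoI e f : e \in edges G -> f \in edges G -> e != f ->
    complex_iso (edge_sphere e :&: edge_sphere f) (order_complex (boolean_hat (d - 2))).
  move=> eG fG; rewrite !edge_sphereE ?edge2 // order_complexI.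
  have [i [j [-> ij]]] := pairP e eG; have [k [l [-> kl]]] := pairP f fG.
  by rewrite subn2; apply: edge_verticesI_iso.
split; first split.
- move=> e eG; have e2 := edge2 e eG.
  have inj : {in edge_perms e &, injective (@facet_of d)}.
    by move=> b b' bP bP'; apply: facet_of_inj2 bP bP'.
  by split; rewrite ?card_in_imset ?card_edge_perms.
- by rewrite facets_coloring_complex.
- by move=> e f eG fG; apply: edge_facets_disjoint; apply: edge2.
- move=> e eG; split; [|exact: isoE|].
    apply: sphere_in_dim_iso; last by rewrite -d1; apply: isoE.
    by rewrite edge_sphereE ?edge2 // is_complex_order_complex.
  by rewrite barycentric_simplex_boundary; apply: isoE.
- split=> [G0|G0].
    rewrite complex_dim_coloring_complex // -subn2 d2 -(subnKC hd) addKn.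
    by rewrite PoszD; lia.
  by rewrite coloring_complexE // G0 big_set0.
move=> e f eG fG ef; split; [|exact: isoI|].
  apply: sphere_in_dim_iso; last by rewrite -d2; apply: isoI.
  by rewrite !edge_sphereE ?edge2 // order_complexI is_complex_order_complex.
move=> i j fE; rewrite !edge_sphereE ?edge2 // order_complexI.
have [a [b [eE ab]]] := pairP e eG.
have ij : i != j.
  by have := edge2 f fG; rewrite fE cards2; case: (i != j).
rewrite fE in ef *; rewrite eE in ef *; exists (half [set a; b] i j), (half [set a; b] j i).
split; first by apply: separates_half => //; rewrite eq_sym.
  by move=> S; apply: vertex_half.
by move=> S; apply: vertex_half.
Qed.
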